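(* There exists a $C^*$-algebra such that the family of all its stable ideals, ordered by inclusion, has no maximal element. In particular, this family does not have a greatest element.
   Context: Ideals are closed two-sided ideals. A $C^*$-algebra $\mathcal A$ is stable if it is $*$-isomorphic to $\mathcal A\otimes\mathcal K(\ell_2)$, where $\mathcal K(\ell_2)$ is the algebra of compact operators on the separable infinite-dimensional Hilbert space $\ell_2$. *)

(* Defs.v *)
From HB Require Import structures.
From mathcomp Require Import all_boot all_order all_algebra.
From mathcomp Require Import complex ring.
From mathcomp Require Import all_classical all_reals all_analysis.

Set Implicit Arguments.
Unset Strict Implicit.
Unset Printing Implicit Defensive.

Import Order.TTheory GRing.Theory Num.Theory.
Import numFieldNormedType.Exports.
Import ComplexField.Normc.

Local Open Scope classical_set_scope.
Local Open Scope complex_scope.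
Local Open Scope ring_scope.

(* Not necessarily unital, hence not built on [nzRingType] or [algType].  The
   norm of a normed module over [R[i]] takes its values in [R[i]]. *)
HB.mixin Record CompleteNormedModule_isCstarAlg (R : realType) A
    of CompleteNormedModule R[i] A := {
  cmul : A -> A -> A;
  cstar : A -> A;
  cmulA : associative cmul;
  cmulDl : left_distributive cmul +%R;
  cmulDr : right_distributive cmul +%R;
  cmulZl : forall (c : R[i]) (x y : A), cmul (c *: x) y = c *: cmul x y;
  cmulZr : forall (c : R[i]) (x y : A), cmul x (c *: y) = c *: cmul x y;
  cstarD : {morph cstar : x y / x + y};
  cstarZ : forall (c : R[i]) (x : A), cstar (c *: x) = c^* *: cstar x;
  cstarM : forall x y : A, cstar (cmul x y) = cmul (cstar y) (cstar x);
  cstarK : involutive cstar;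
  cnormM : forall x y : A, `|cmul x y| <= `|x| * `|y|;
  cnorm_star : forall x : A, `|cmul (cstar x) x| = `|x| ^+ 2
}.

#[short(type="cstarAlgType")]
HB.structure Definition CstarAlg (R : realType) :=
  {A of CompleteNormedModule R[i] A & CompleteNormedModule_isCstarAlg R A}.

Definition star_morphism (R : realType) (A B : cstarAlgType R) (f : A -> B) :=
  [/\ linear f,
      {morph f : x y / cmul x y}
    & {morph f : x / cstar x}].

Definition star_isomorphic (R : realType) (A B : cstarAlgType R) :=
  exists f : A -> B, star_morphism f /\ bijective f.

Definition square_summable (R : realType) : {pred nat -> R[i]} :=
  fun x => `[< cvgn (series (fun n => normc (x n) ^+ 2)) >].

Lemma square_summable_submod_closed (R : realType) :
  submod_closed (@square_summable R).
Proof.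
split.
  apply/asboolP; rewrite (_ : (fun n => _) = (fun=> 0)); last first.
    by apply/funext => n; rewrite normc0 expr0n.
  rewrite (_ : series _ = cst 0); first exact: is_cvg_cst.
  by apply/funext => n; rewrite /series /= big1.
move=> a x y /asboolP cx /asboolP cy; apply/asboolP.
pose v n : R := (2 * normc a ^+ 2) * normc (x n) ^+ 2 + 2 * normc (y n) ^+ 2.
have normc_ge0 z : 0 <= @normc R z by case: z => u w; exact: sqrtr_ge0.
apply: (@series_le_cvg _ _ v) => [n|n|n|].
- exact: sqr_ge0.
- by apply: addr_ge0; do ?[exact: sqr_ge0 | apply: mulr_ge0 | exact: ler0n].
- have nD : normc (a * x n + y n) <= normc a * normc (x n) + normc (y n).
    by rewrite -normcM le_normcD.
  apply: (@le_trans _ _ ((normc a * normc (x n) + normc (y n)) ^+ 2)).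
    by rewrite ler_sqr// nnegrE ?normc_ge0// addr_ge0 ?mulr_ge0 ?normc_ge0.
  rewrite -subr_ge0 (_ : _ - _ = (normc a * normc (x n) - normc (y n)) ^+ 2).
    exact: sqr_ge0.
  by rewrite /v; ring.
- rewrite (_ : v = (2 * normc a ^+ 2) *: (fun n => normc (x n) ^+ 2) +
                   2 *: (fun n => normc (y n) ^+ 2)) //.
  by apply: is_cvg_seriesD; apply: is_cvg_seriesZ.
Qed.

HB.instance Definition _ (R : realType) :=
  GRing.isSubmodClosed.Build R[i] (nat -> R[i]) (@square_summable R)
    (@square_summable_submod_closed R).

Record ell2 (R : realType) := Ell2 {
  ell2val :> nat -> R[i];
  ell2valP : ell2val \in @square_summable R }.

HB.instance Definition _ (R : realType) := [isSub for @ell2val R].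
HB.instance Definition _ (R : realType) := [Choice of ell2 R by <:].
HB.instance Definition _ (R : realType) :=
  [SubChoice_isSubLmodule of ell2 R by <:].

Definition ell2_inner (R : realType) (x y : ell2 R) : R[i] :=
  limn (series (fun n => x n * (y n)^* : R[i]^o)).

Definition ell2_norm (R : realType) (x : ell2 R) : R :=
  Num.sqrt (limn (series (fun n => normc (x n) ^+ 2))).

Definition opnorm (R : realType) (T : ell2 R -> ell2 R) : R :=
  sup [set ell2_norm (T x) | x in [set x | ell2_norm x <= 1]].

Definition compact_operator (R : realType) (T : ell2 R -> ell2 R) :=
  linear T /\
  forall u : nat -> ell2 R, (exists M : R, forall n, ell2_norm (u n) <= M) ->
  exists (k : nat -> nat) (y : ell2 R),
    {homo k : m n / (m < n)%N} /\
    (fun n => ell2_norm (T (u (k n)) - y)) @ \oo --> (0 : R).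

(* [K] is the C*-algebra of compact operators on [ell2 R], [rho] sending an
   element of [K] to the operator that it is; this determines [K] up to
   isometric *-isomorphism. *)
Definition is_compact_operators (R : realType) (K : cstarAlgType R)
    (rho : K -> ell2 R -> ell2 R) :=
  [/\ [/\ linear rho,
          forall a b, rho (cmul a b) = rho a \o rho b
        & forall a x y, ell2_inner (rho a x) y = ell2_inner x (rho (cstar a) y)],
      forall a : K, `|a| = (opnorm (rho a))%:C
    & range rho = @compact_operator R].

(* The element \sum_i a_i (x) b_i of the algebraic tensor product vanishes: by
   the universal property, every bilinear map kills it. *)
Definition tensor_eq0 (R : realType) (A B : lmodType R[i]) (s : seq (A * B)) :=
  forall (V : lmodType R[i]) (phi : {bilinear A -> B -> V}),
    \sum_(p <- s) phi p.1 p.2 = 0.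

(* [T] is a C*-completion of the algebraic tensor product of [A] and [B], with
   [tau a b] the elementary tensor a (x) b. When one factor is nuclear, such as
   the algebra of compact operators, there is exactly one C*-norm on the
   algebraic tensor product, hence exactly one such completion. *)
Definition is_Cstar_tensor (R : realType) (A B T : cstarAlgType R)
    (tau : {bilinear A -> B -> T}) :=
  [/\ forall a a' b b', tau (cmul a a') (cmul b b') = cmul (tau a b) (tau a' b'),
      forall a b, tau (cstar a) (cstar b) = cstar (tau a b),
      forall s : seq (A * B),
        \sum_(p <- s) tau p.1 p.2 = 0 -> tensor_eq0 s
    & dense [set t | exists s : seq (A * B), t = \sum_(p <- s) tau p.1 p.2]].

Definition stable (R : realType) (A : cstarAlgType R) :=
  exists (K : cstarAlgType R) (rho : K -> ell2 R -> ell2 R),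
    is_compact_operators rho /\
  exists (T : cstarAlgType R) (tau : {bilinear A -> K -> T}),
    is_Cstar_tensor tau /\ star_isomorphic A T.

Definition closed_ideal (R : realType) (A : cstarAlgType R) (I : set A) :=
  [/\ closed I,
      I 0,
      forall (c : R[i]) x y, I x -> I y -> I (c *: x + y)
    & forall a x, I x -> I (cmul a x) /\ I (cmul x a)].

(* [B] is the C*-algebra [I], with the operations and norm of [A]; [iota] is
   the inclusion. *)
Definition is_sub_Cstar (R : realType) (A B : cstarAlgType R) (I : set A)
    (iota : B -> A) :=
  [/\ star_morphism iota, forall b, `|iota b| = `|b| & range iota = I].

Definition stable_ideal (R : realType) (A : cstarAlgType R) (I : set A) :=
  closed_ideal I /\
  exists (B : cstarAlgType R) (iota : B -> A), is_sub_Cstar I iota /\ stable B.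

Definition maximal_in (T : Type) (F : set (set T)) (I : set T) :=
  F I /\ forall J, F J -> I `<=` J -> J = I.

Definition greatest_in (T : Type) (F : set (set T)) (I : set T) :=
  F I /\ forall J, F J -> J `<=` I.

(* Main.v *)
(** A C*-algebra [C] is stable if and only if it contains densely a *-algebra
    of the form [B (x) M_oo], where [M_oo] is the *-algebra of finite matrices:
    given such matrices, the shifts [e_kl |-> e_<i,k><j,l>] along a pairing
    [<_,_>] of the natural numbers are isometric, extend to compressions
    [v_i x v_j^*] of [C], and these assemble to a tensor product [C (x) K] with
    completion [C] again.  Conversely a tensor map is automatically bounded,
    because a self-adjoint contraction is the real part of a unitary of the
    unitization.

    The counterexample consists of bounded [K]-valued functions on the tree of
    finite sequences of projections [q] of [K].  It is generated, over all
    branches [xi] of the tree, by the functions [f] supported on [xi] for which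
    [u_m f(xi_m) u_m] converges, [u_m = 1 - 2 xi(m)].  Two branches share only
    finitely many nodes, so that these functions form an ideal [D_xi] and may be
    split off from any other ideal.  Hence a stable ideal [I] remains stable
    after adding [D_xi]: use the matrices of [I] off the branch and those of
    [D_xi] on it.  So a maximal stable ideal contains every [D_xi] and is the
    whole algebra, which is not stable: given matrices over it, choose at each
    node of level [n] a reflection moving a fixed minimal projection into the
    corner [e_nn], and let these choices themselves trace a branch; the
    translates of the minimal projection along that branch form an element that
    no finite matrix approximates. *)

Require Import Defs.
From HB Require Import structures.
From mathcomp Require Import all_boot all_order all_algebra.
From mathcomp Require Import complex ring lra.
From mathcomp Require Import all_classical all_reals all_analysis.

Set Implicit Arguments.
Unset Strict Implicit.
Unset Printing Implicit Defensive.

Import Order.TTheory GRing.Theory Num.Theory.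
Import numFieldNormedType.Exports.
Import ComplexField.Normc.

Local Open Scope classical_set_scope.
Local Open Scope complex_scope.
Local Open Scope ring_scope.

(** * Real-valued norms and sequential completeness *)

(** At the node [mkseq xi m] a section over [xi] is twisted by [theta (xi m)], that is, by the next
    letter of the branch. So every reflection occurs at every node, and two branches that use
    different reflections at a node part right there. Hence reflections chosen at the nodes
    independently of each other are always followed by one branch, as the diagonal argument
    requires; yet each single branch has one trivialization, in which its sections are the
    convergent [K]-valued sequences. Sections tending to 0 would not do: they generate the functions
    on the tree that vanish at infinity, and these form a stable algebra.

    Reflections replace general unitaries because [k |-> (1 - 2 q) k (1 - 2 q)] can be written
    inside [K], is an isometric involution, and still moves a minimal projection far enough.

    Functional calculus and positivity are bypassed by a square root obtained by iteration and a
    norm inequality read off from [a + i b] and [a - i b]. *)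

Lemma normc_nneg (R : realType) (z : R[i]) : 0 <= normc z.
Proof. by case: z => a b; exact: sqrtr_ge0. Qed.

Section Norm.
Variables (R : realType) (V : normedModType R[i]).
Implicit Types x y : V.

(* The norm of [V] is [R[i]]-valued; this is its real value. *)
Definition nrm x : R := complex.Re `|x|.

Lemma nrmE x : `|x| = (nrm x)%:C.
Proof.
by rewrite /nrm RRe_real.
Qed.

Lemma nrm_ge0 x : 0 <= nrm x.
Proof. by rewrite -ler0c -nrmE. Qed.

Lemma nrm0 : nrm 0 = 0.
Proof. by rewrite /nrm normr0. Qed.

Lemma nrm0_eq0 x : nrm x = 0 -> x = 0.
Proof. by move=> x0; apply/normr0_eq0; rewrite nrmE x0. Qed.

Lemma nrm_gt0 x : x != 0 -> 0 < nrm x.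
Proof.
move=> x0; rewrite lt_neqAle nrm_ge0 andbT eq_sym.
by apply: contra_neq x0 => /nrm0_eq0.
Qed.

Lemma nrmD x y : nrm (x + y) <= nrm x + nrm y.
Proof. by rewrite -lecR raddfD /= -!nrmE ler_normD. Qed.

Lemma nrmBC x y : nrm (x - y) = nrm (y - x).
Proof. by rewrite /nrm distrC. Qed.

Lemma nrm_tri y x z : nrm (x - z) <= nrm (x - y) + nrm (y - z).
Proof. by rewrite -[x - z](subrKA y) nrmD. Qed.

Lemma nrmZ (c : R[i]) x : nrm (c *: x) = normc c * nrm x.
Proof. by apply: complexI; rewrite rmorphM /= -!nrmE normrZ. Qed.

Lemma nrmB_ge x y : nrm x - nrm y <= nrm (x - y).
Proof. by rewrite lerBlDr -{1}(subrK y x) nrmD. Qed.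

Lemma nrm_le_eps x : (forall e, 0 < e -> nrm x <= e) -> x = 0.
Proof.
move=> xe; apply: nrm0_eq0; apply/eqP; rewrite eq_le nrm_ge0 andbT.
by apply/ler_addgt0Pr => e e0; rewrite add0r xe.
Qed.

Definition near_set (S : set V) x :=
  forall e : R, 0 < e -> exists2 y, S y & nrm (x - y) < e.

Lemma ballP x y (e : R) : ball x e%:C y <-> nrm (x - y) < e.
Proof. by rewrite -ball_normE /ball_ /= nrmE ltcR. Qed.

Lemma nbhs_nrm x (A : set V) :
  nbhs x A <-> exists2 e : R, 0 < e & forall y, nrm (x - y) < e -> A y.
Proof.
rewrite nbhs_ballP; split=> [[e /= e0 eA]|[e e0 eA]].
  have er : e = (complex.Re e)%:C by rewrite RRe_real// realE (ltW e0).
  exists (complex.Re e); first by rewrite -ltcR -er.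
  by move=> y xy; apply: eA; rewrite er; apply/ballP.
exists e%:C; first by rewrite /= ltcR.
by move=> y /ballP; exact: eA.
Qed.

Lemma near_set_closure (S : set V) x : near_set S x <-> closure S x.
Proof.
split=> [Sx A /nbhs_nrm[e e0 eA]|Sx e e0].
  by have [y Sy /eA Ay] := Sx e e0; exists y.
have [|y [Sy xy]] := Sx (fun y => nrm (x - y) < e).
  by apply/nbhs_nrm; exists e.
by exists y.
Qed.

Lemma closed_nrm (S : set V) : closed S <-> near_set S `<=` S.
Proof.
by split=> SS x; [move/near_set_closure/SS | move/(near_set_closure S x).2/SS].
Qed.

Lemma dense_nrm (S : set V) : dense S <-> forall x, near_set S x.
Proof.
split=> [dS x e e0|dS O [x Ox] oO].
  have [||y [/= xy Sy]] := dS (ball x e%:C)^°.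
  - exists x; apply/nbhs_nrm; exists e => // y xy.
    by apply/ballP.
  - exact: open_interior.
  - by exists y => //; apply/ballP; exact: interior_subset xy.
have /nbhs_nrm[e e0 eO] : nbhs x O by exact: open_nbhs_nbhs.
by have [y Sy /eO Oy] := dS x e e0; exists y.
Qed.

Definition tends (u : nat -> V) x :=
  forall e : R, 0 < e -> exists N, forall n, (N <= n)%N -> nrm (u n - x) < e.

Definition cauchy_nrm (u : nat -> V) :=
  forall e : R, 0 < e -> exists N, forall m n, (N <= m)%N -> (N <= n)%N ->
    nrm (u m - u n) < e.

Lemma tends_unique u x y : tends u x -> tends u y -> x = y.
Proof.
move=> ux uy; apply/subr0_eq/nrm_le_eps => e e0.
have [N Nx] := ux (e / 2) ltac:(by rewrite divr_gt0).
have [M My] := uy (e / 2) ltac:(by rewrite divr_gt0).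
have := Nx (maxn N M) (leq_maxl _ _); have := My (maxn N M) (leq_maxr _ _).
have := nrm_tri (u (maxn N M)) x y; rewrite (nrmBC x (u _)); lra.
Qed.

Lemma tends_near (S : set V) u x : tends u x -> (forall n, S (u n)) ->
  near_set S x.
Proof.
move=> ux Su e e0; have [N Nx] := ux e e0; exists (u N) => //.
by rewrite nrmBC; exact: Nx.
Qed.

End Norm.

Lemma complete_nrm (R : realType) (V : completeNormedModType R[i])
  (u : nat -> V) : cauchy_nrm u -> exists x, tends u x.
Proof.
move=> cu; have : cvg (u @ \oo).
  apply: cauchy_cvg; apply: cauchy_exP => e e0.
  have er : e = (complex.Re e)%:C by rewrite RRe_real// realE (ltW e0).
  have [|N Nu] := cu (complex.Re e); first by rewrite -ltcR -er.
  exists (u N); rewrite er; exists N => // n /= Nn; apply/ballP.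
  exact: Nu.
move=> /cvg_ex[x ux]; exists x => e e0.
have /ux : nbhs x (fun y => nrm (x - y) < e) by apply/nbhs_nrm; exists e.
by move=> [N _ Nu]; exists N => n Nn; rewrite nrmBC; exact: Nu.
Qed.

(* A sequence of centres of balls of radius [1/(n+1)] in the filter is Cauchy,
   so sequential completeness suffices. *)
Lemma cauchy_filter_nrm (R : realType) (V : normedModType R[i])
  (F : set_system V) : (forall u : nat -> V, cauchy_nrm u -> exists x, tends u x) ->
  ProperFilter F -> cauchy F -> cvg F.
Proof.
move=> compl FF /cauchyP cF.
have pos n : (0 : R[i]) < (n.+1%:R^-1 : R)%:C by rewrite ltcR invr_gt0.
pose u n := xget 0 [set x | F (ball x (n.+1%:R^-1 : R)%:C)].
have Fu n : F (ball (u n) (n.+1%:R^-1 : R)%:C).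
  have [x Fx] := cF _ (pos n).
  by rewrite /u; case: xgetP => [y _ //|/(_ x)].
have uu m n : nrm (u m - u n) < m.+1%:R^-1 + n.+1%:R^-1.
  have [x [/ballP ux /ballP xu]] := @filter_ex _ _ FF _ (filterI (Fu m) (Fu n)).
  by apply: le_lt_trans (nrm_tri x _ _) _; rewrite (nrmBC x) ltrD.
have small (e : R) : 0 < e -> exists N, forall n, (N <= n)%N -> n.+1%:R^-1 < e.
  move=> e0; have [N Ne] : exists N : nat, e^-1 < N%:R.
    by exists (Num.trunc e^-1).+1; rewrite Num.Theory.truncnS_gt.
  exists N => n Nn; rewrite -[e]invrK ltf_pV2 ?posrE ?invr_gt0//.
  by apply: (lt_le_trans Ne); rewrite ler_nat leqW.
have [x ux] : exists x, tends u x.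
  apply: compl => e e0; have [N Ne] := small (e / 2) ltac:(by rewrite divr_gt0).
  exists N => m n /Ne mN /Ne nN; by apply: lt_trans (uu m n) _; rewrite [e]splitr ltrD.
apply/cvg_ex; exists x => A /nbhs_nrm[e e0 eA].
have [N Nx] := ux (e / 2) ltac:(by rewrite divr_gt0).
have [M Me] := small (e / 2) ltac:(by rewrite divr_gt0).
set k := maxn N M; apply: filterS (Fu k) => y /ballP uy; apply: eA.
apply: le_lt_trans (nrm_tri (u k) x y) _; rewrite [e]splitr ltrD//.
  by rewrite nrmBC Nx// leq_maxl.
exact: lt_trans uy (Me k (leq_maxr _ _)).
Qed.

(** * C*-algebras from a real-valued norm *)

(** The algebras built below come with a real norm and completeness for sequences; the builders turn
    these into the [R[i]]-valued norm and the completeness for filters of [cstarAlgType]. *)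
HB.factory Record Lmodule_isCstarAlg (R : realType) A
    & GRing.Lmodule R[i] A := {
  rnorm : A -> R;
  rnormD : forall x y, rnorm (x + y) <= rnorm x + rnorm y;
  rnormZ : forall (c : R[i]) x, rnorm (c *: x) = normc c * rnorm x;
  rnorm_eq0 : forall x, rnorm x = 0 -> x = 0;
  rnorm_complete : forall u : nat -> A,
    (forall e : R, 0 < e -> exists N, forall m n, (N <= m)%N -> (N <= n)%N ->
      rnorm (u m - u n) < e) ->
    exists x, forall e : R, 0 < e -> exists N, forall n, (N <= n)%N ->
      rnorm (u n - x) < e;
  fmul : A -> A -> A;
  fstar : A -> A;
  fmulA : associative fmul;
  fmulDl : left_distributive fmul +%R;
  fmulDr : right_distributive fmul +%R;
  fmulZl : forall (c : R[i]) (x y : A), fmul (c *: x) y = c *: fmul x y;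
  fmulZr : forall (c : R[i]) (x y : A), fmul x (c *: y) = c *: fmul x y;
  fstarD : {morph fstar : x y / x + y};
  fstarZ : forall (c : R[i]) (x : A), fstar (c *: x) = c^* *: fstar x;
  fstarM : forall x y : A, fstar (fmul x y) = fmul (fstar y) (fstar x);
  fstarK : involutive fstar;
  rnormM : forall x y : A, rnorm (fmul x y) <= rnorm x * rnorm y;
  rnorm_star : forall x : A, rnorm (fmul (fstar x) x) = rnorm x ^+ 2
}.

HB.builders Context (R : realType) A & Lmodule_isCstarAlg R A.

Let cnorm (x : A) : R[i] := (rnorm x)%:C.

Let cnormD x y : cnorm (x + y) <= cnorm x + cnorm y.
Proof. by rewrite /cnorm -rmorphD lecR rnormD. Qed.

Let cnormZ (c : R[i]) x : cnorm (c *: x) = `|c| * cnorm x.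
Proof. by rewrite /cnorm rnormZ rmorphM. Qed.

Let cnorm_eq0 x : cnorm x = 0 -> x = 0.
Proof. by move=> /complexI /rnorm_eq0. Qed.

HB.instance Definition _ := Lmodule_isNormed.Build R[i] A cnormD cnormZ cnorm_eq0.

Let A_complete (F : set_system A) : ProperFilter F -> cauchy F -> cvg F.
Proof. by apply: cauchy_filter_nrm; exact: rnorm_complete. Qed.

HB.instance Definition _ := Uniform_isComplete.Build A A_complete.

Let cnormMl (x y : A) : `|fmul x y| <= `|x| * `|y|.
Proof. by rewrite -[X in X <= _]/((rnorm _)%:C) -rmorphM lecR rnormM. Qed.

Let cnorm_starE (x : A) : `|fmul (fstar x) x| = `|x| ^+ 2.
Proof. by rewrite -[LHS]/((rnorm _)%:C) rnorm_star rmorphXn. Qed.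

HB.instance Definition _ := CompleteNormedModule_isCstarAlg.Build R A
  fmulA fmulDl fmulDr fmulZl fmulZr fstarD fstarZ fstarM fstarK
  cnormMl cnorm_starE.

HB.end.

Local Notation "x ** y" := (cmul x y) (at level 40, left associativity).
Local Notation "x ^#" := (cstar x) (at level 2, format "x ^#").

Section CstarBasics.
Variables (R : realType) (A : cstarAlgType R).
Implicit Types x y z : A.

Lemma cmul0l x : 0 ** x = 0.
Proof. by rewrite -{1}(scale0r (0 : A)) cmulZl scale0r. Qed.

Lemma cmul0r x : x ** 0 = 0.
Proof. by rewrite -{1}(scale0r (0 : A)) cmulZr scale0r. Qed.

Lemma cmulNl x y : (- x) ** y = - (x ** y).
Proof. by rewrite -scaleN1r cmulZl scaleN1r. Qed.

Lemma cmulNr x y : x ** (- y) = - (x ** y).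
Proof. by rewrite -scaleN1r cmulZr scaleN1r. Qed.

Lemma cmulBl x y z : (x - y) ** z = x ** z - y ** z.
Proof. by rewrite cmulDl cmulNl. Qed.

Lemma cmulBr x y z : z ** (x - y) = z ** x - z ** y.
Proof. by rewrite cmulDr cmulNr. Qed.

Lemma cmul_suml (I : Type) (r : seq I) (P : pred I) (F : I -> A) y :
  (\sum_(i <- r | P i) F i) ** y = \sum_(i <- r | P i) F i ** y.
Proof. by apply: (big_morph (fun x => x ** y)) => [a b|]; rewrite ?cmulDl ?cmul0l. Qed.

Lemma cmul_sumr (I : Type) (r : seq I) (P : pred I) (F : I -> A) y :
  y ** (\sum_(i <- r | P i) F i) = \sum_(i <- r | P i) y ** F i.
Proof. by apply: (big_morph (cmul y)) => [a b|]; rewrite ?cmulDr ?cmul0r. Qed.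

Lemma cstar0 : (0 : A)^# = 0.
Proof. by rewrite -{1}(scale0r (0 : A)) cstarZ rmorph0 scale0r. Qed.

Lemma cstarN x : (- x)^# = - x^#.
Proof. by apply/eqP; rewrite -addr_eq0 -cstarD addNr cstar0. Qed.

Lemma cstarB x y : (x - y)^# = x^# - y^#.
Proof. by rewrite cstarD cstarN. Qed.

Lemma cstar_sum (I : Type) (r : seq I) (P : pred I) (F : I -> A) :
  (\sum_(i <- r | P i) F i)^# = \sum_(i <- r | P i) (F i)^#.
Proof. by apply: (big_morph (@cstar _ A)) => [a b|]; rewrite ?cstarD ?cstar0. Qed.

Lemma nrmM x y : nrm (x ** y) <= nrm x * nrm y.
Proof. by rewrite -lecR rmorphM /= -!nrmE cnormM. Qed.

Lemma nrm_star x : nrm (x^# ** x) = nrm x ^+ 2.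
Proof. by apply: complexI; rewrite rmorphXn /= -!nrmE cnorm_star. Qed.

Lemma nrm_cstar x : nrm x^# = nrm x.
Proof.
have le y : nrm y <= nrm y^#.
  have [->|y0] := eqVneq y 0; first by rewrite nrm0 nrm_ge0.
  by rewrite -(ler_pM2r (nrm_gt0 y0)) -expr2 -nrm_star nrmM.
by apply/eqP; rewrite eq_le le andbT -{2}[x]cstarK le.
Qed.

Lemma nrm_starr x : nrm (x ** x^#) = nrm x ^+ 2.
Proof. by rewrite -{1}[x]cstarK nrm_star nrm_cstar. Qed.

Lemma cstar_mul_eq0 x : x^# ** x = 0 -> x = 0.
Proof.
move=> x0; apply: nrm0_eq0; apply/eqP; rewrite -sqrf_eq0 -nrm_star x0.
by rewrite nrm0.
Qed.

(** Taking [a = b = x^#] kills [(x^# x)^# (x^# x)], and the C*-identity applies twice. This replaces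
    multiplication by a unit. *)
Lemma cmul_sandwich_eq0 x : (forall a b, a ** x ** b = 0) -> x = 0.
Proof.
move=> x0; apply: cstar_mul_eq0; apply: cstar_mul_eq0.
by rewrite cstarM cstarK cmulA x0 cmul0l.
Qed.

Lemma tends_cmul (u v : nat -> A) x y : tends u x -> tends v y ->
  tends (fun n => u n ** v n) (x ** y).
Proof.
move=> ux vy e e0.
have [N Nx] := ux 1 ltr01.
have c0 : 0 < e / (2 * (nrm x + nrm y + 1)).
  by rewrite divr_gt0// mulr_gt0//; have := nrm_ge0 x; have := nrm_ge0 y; lra.
have [M Mx] := ux _ c0; have [P Py] := vy _ c0.
exists (maxn N (maxn M P)) => n; rewrite !geq_max => /and3P[/Nx nN /Mx nM /Py nP].
have -> : u n ** v n - x ** y = u n ** (v n - y) + (u n - x) ** y.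
  by rewrite cmulBl cmulBr subrKA.
apply: le_lt_trans (nrmD _ _) _.
apply: (@le_lt_trans _ _ ((nrm x + 1) * nrm (v n - y) + nrm (u n - x) * nrm y)).
  apply: lerD; last exact: nrmM.
  apply: le_trans (nrmM _ _) _; apply: ler_wpM2r; first exact: nrm_ge0.
  have := nrmB_ge (u n) x; lra.
apply: (@le_lt_trans _ _ ((nrm x + 1) * (e / (2 * (nrm x + nrm y + 1)))
    + (e / (2 * (nrm x + nrm y + 1))) * nrm y)).
  apply: lerD; [apply: ler_wpM2l; last exact: ltW | apply: ler_wpM2r; last exact: ltW].
    by have := nrm_ge0 x; lra.
  exact: nrm_ge0.
rewrite [(_ * nrm y)]mulrC -mulrDl (_ : nrm x + 1 + nrm y = nrm x + nrm y + 1); last by ring.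
have h : 0 < nrm x + nrm y + 1 by have := nrm_ge0 x; have := nrm_ge0 y; lra.
set d := nrm x + nrm y + 1 in h *.
rewrite (_ : d * (e / (2 * d)) = e / 2); first lra.
by field; rewrite gt_eqF.
Qed.

Lemma tends_cst x : tends (fun=> x) x.
Proof. by move=> e e0; exists 0%N => n _; rewrite subrr nrm0. Qed.

Lemma tendsD (u v : nat -> A) x y : tends u x -> tends v y ->
  tends (fun n => u n + v n) (x + y).
Proof.
move=> ux vy e e0.
have [N Nx] := ux (e / 2) ltac:(by rewrite divr_gt0).
have [M My] := vy (e / 2) ltac:(by rewrite divr_gt0).
exists (maxn N M) => n; rewrite geq_max => /andP[/Nx nN /My nM].
rewrite opprD addrACA; apply: le_lt_trans (nrmD _ _) _; lra.
Qed.

Lemma tendsZ (c : R[i]) (u : nat -> A) x : tends u x ->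
  tends (fun n => c *: u n) (c *: x).
Proof.
move=> ux e e0; have c0 := normc_nneg c.
have [|N Nx] := ux (e / (normc c + 1)); first by rewrite divr_gt0//; lra.
exists N => n /Nx; rewrite -scalerBr nrmZ ltr_pdivlMr; last lra.
by have := nrm_ge0 (u n - x); nra.
Qed.

Lemma tends_cstar (u : nat -> A) x : tends u x -> tends (fun n => (u n)^#) x^#.
Proof.
move=> ux e /ux[N Nx]; exists N => n /Nx.
by rewrite -cstarB nrm_cstar.
Qed.

End CstarBasics.

(** * Square roots and automatic boundedness *)

Lemma half_expn_lt (R : realType) (e : R) : 0 < e -> exists n, 2^-1 ^+ n < e.
Proof.
move=> e0; exists (Num.trunc e^-1).+1.
rewrite exprVn -[X in _ < X]invrK ltf_pV2 ?posrE ?invr_gt0 ?exprn_gt0//.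
apply: lt_trans (truncnS_gt _) _.
by rewrite -natrX ltr_nat; apply: ltn_expl.
Qed.

Lemma conjR (R : realType) (x : R) : (x%:C : R[i])^* = x%:C.
Proof. exact: conjc_real. Qed.

Lemma realC (R : realType) (x : R) : normc x%:C = `|x|.
Proof. by rewrite /normc /= expr0n addr0 sqrtr_sqr. Qed.

Lemma nrmZR (R : realType) (V : normedModType R[i]) (c : R) (x : V) :
  nrm (c%:C *: x) = `|c| * nrm x.
Proof. by rewrite nrmZ realC. Qed.

Section SquareRoot.
Variables (R : realType) (A : cstarAlgType R).
Implicit Types h z : A.

(* [1 + z] is the square root of [1 - h^2]; it lives in the unitization, its
   part [z] is the fixed point of [z = - (h^2 + z^2) / 2]. *)
Lemma sqrt_one_minus_sqr h : h^# = h -> nrm h <= 2^-1 ->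
  exists z, [/\ z^# = z, h ** z = z ** h, h ** h + (z + z) + z ** z = 0
              & forall c, c ** h = h -> c ** z = z].
Proof.
move=> hs h2; pose F z := - (2^-1 : R)%:C *: (h ** h + z ** z).
have rh : `|- (2^-1 : R)| = 2^-1 by rewrite normrN gtr0_norm.
(* On the ball of radius 1/2, which [F] preserves as [nrm h <= 1/2], this is a contraction of ratio
   1/2. *)
have nF z w : nrm (F z - F w) <= 2^-1 * ((nrm z + nrm w) * nrm (z - w)).
  rewrite /F -scalerBr opprD addrACA subrr add0r -rmorphN nrmZR rh ler_pM2l//.
  have -> : z ** z - w ** w = z ** (z - w) + (z - w) ** w.
    by rewrite cmulBl cmulBr subrKA.
  rewrite mulrDl [nrm w * _]mulrC.
  by apply: le_trans (nrmD _ _) (lerD _ _); exact: nrmM.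
pose u n := iter n F 0.
have u2 n : nrm (u n) <= 2^-1.
  elim: n => [|n IH]; first by rewrite /= nrm0 invr_ge0.
  rewrite /= /F -rmorphN nrmZR rh.
  have := nrmM h h; have := nrmM (u n) (u n); have := nrmD (h ** h) (u n ** u n).
  by have := nrm_ge0 h; have := nrm_ge0 (u n); rewrite -/(u n); nra.
have uu n k : nrm (u (n + k)%N - u n) <= 2^-1 ^+ n.
  elim: n => [|n IH]; first by rewrite expr0 subr0; have := u2 (0 + k)%N; lra.
  rewrite addSn /= exprS; apply: le_trans (nF _ _) _; rewrite ler_pM2l//.
  have := u2 n; have := u2 (n + k)%N; have := nrm_ge0 (u (n + k)%N - u n).
  by move: IH; rewrite -!/(u _); nra.
have [z uz] : exists z, tends u z.
  apply: complete_nrm => e /half_expn_lt[N Ne]; exists N.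
  have half n : (N <= n)%N -> (2^-1 : R) ^+ n <= 2^-1 ^+ N.
    by move=> Nn; apply: ler_wiXn2l; rewrite ?invr_ge0// invf_le1 ?ler1n.
  suff uuN m n : (N <= m)%N -> (m <= n)%N -> nrm (u m - u n) < e.
    move=> m n Nm Nn; have [mn|/ltnW nm] := leqP m n; first exact: uuN.
    by rewrite nrmBC; exact: uuN.
  move=> Nm mn; rewrite nrmBC -(subnKC mn).
  exact: le_lt_trans (uu _ _) (le_lt_trans (half _ Nm) Ne).
have zF : z = F z.
  apply: (@tends_unique _ _ (fun n => u n.+1)).
    by move=> e /uz[N Nu]; exists N => n Nn; apply: Nu; rewrite leqW.
  by apply: tendsZ; apply: tendsD; [exact: tends_cst | exact: tends_cmul].
have lim_eq (f g : A -> A) : (forall v x, tends v x -> tends (f \o v) (f x)) ->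
    (forall v x, tends v x -> tends (g \o v) (g x)) ->
    (forall n, f (u n) = g (u n)) -> f z = g z.
  move=> cf cg fg; apply: tends_unique (cf _ _ uz) _.
  by rewrite (_ : f \o u = g \o u); [exact: cg | apply/funext => n; exact: fg].
have mulc (a : A) v x : tends v x -> tends (cmul a \o v) (a ** x).
  by move=> vx; apply: tends_cmul vx; exact: tends_cst.
exists z; split.
- apply: (lim_eq (@cstar _ A) id) => // [v x|n]; first exact: tends_cstar.
  elim: n => [|n IH]; first by rewrite /= cstar0.
  rewrite /= /F cstarZ cstarD !cstarM hs IH; congr (_ *: _).
  by rewrite rmorphN /= conjR.
- apply: (lim_eq (cmul h) (cmul^~ h)) => [v x|v x vx|n]; first exact: mulc.
    by apply: tends_cmul => //; exact: tends_cst.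
  elim: n => [|n IH]; first by rewrite /= cmul0l cmul0r.
  rewrite /= /F cmulZr cmulZl cmulDr cmulDl !cmulA; congr (_ *: (_ + _)).
  by rewrite -/(u n) IH -!cmulA IH.
- have : z + z = - (h ** h + z ** z).
    rewrite {1 2}zF /F -scalerDl -opprD -rmorphD /=.
    by rewrite (_ : 2^-1 + 2^-1 = 1) ?scaleN1r//; lra.
  by move=> ->; rewrite addrAC subrr.
(* This localizes the root: a left unit of [h], such as the unit of a corner, is also one of [z]. *)
- move=> c ch; apply: (lim_eq (cmul c) id) => // [v x|n]; first exact: mulc.
  elim: n => [|n IH]; first by rewrite /= cmul0r.
  by rewrite /= /F cmulZr cmulDr !cmulA ch -/(u n) IH.
Qed.

End SquareRoot.

(** The hypothesis cancels the cross terms, so that [a + i b] and [a - i b] both have square norm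
    [nrm (a^# ** a + b^# ** b)] by the C*-identity; [a] is their mean. *)
Lemma nrm_le_sqr_sum (R : realType) (A : cstarAlgType R) (a b : A) :
  a^# ** b = b^# ** a -> nrm a ^+ 2 <= nrm (a^# ** a + b^# ** b).
Proof.
move=> ab; pose i := ('i : R[i]).
have ii : i * i = -1 by rewrite -expr2 sqr_i.
have conji : (i : R[i])^* = - i by apply/eqP; rewrite eq_complex /= oppr0 !eqxx.
have nu (s : R[i]) : s = i \/ s = - i ->
    nrm (a + s *: b) ^+ 2 = nrm (a^# ** a + b^# ** b).
  move=> si; have sJ : s^* = - s by case: si => ->; rewrite ?rmorphN /= conji.
  have ss : s * s = -1 by case: si => ->; rewrite ?mulrNN.
  rewrite -nrm_star cstarD cstarZ sJ cmulDl !cmulDr !cmulZl !cmulZr.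
  rewrite !scalerA mulNr ss opprK scale1r ab scaleNr.
  by rewrite -addrA [_ + (- _ + _)]addrA subrr add0r.
have aE : a = (2^-1 : R)%:C *: ((a + i *: b) + (a + (- i) *: b)).
  rewrite addrACA scaleNr subrr addr0 scalerDr -scalerDl -rmorphD /=.
  by rewrite (_ : 2^-1 + 2^-1 = 1) ?scale1r//; lra.
set n := nrm (a^# ** a + b^# ** b) in nu *.
have n1 := nu i (or_introl erefl); have n2 := nu (- i) (or_intror erefl).
have na : nrm a = 2^-1 * nrm ((a + i *: b) + (a + (- i) *: b)).
  by rewrite {1}aE nrmZR gtr0_norm ?invr_gt0.
have := nrmD (a + i *: b) (a + (- i) *: b); rewrite na.
have := nrm_ge0 (a + i *: b); have := nrm_ge0 (a + (- i) *: b).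
have := nrm_ge0 ((a + i *: b) + (a + (- i) *: b)).
move: n1 n2; set m1 := nrm (_ + i *: _); set m2 := nrm (_ + - i *: _).
set t := nrm _ => n1 n2 t0 m20 m10 tm; apply: (@le_trans _ _ ((2^-1 * (m1 + m2)) ^+ 2)).
  by rewrite ler_sqr ?nnegrE; lra.
by move: n1 n2; have := sqr_ge0 (m1 - m2); rewrite !expr2; lra.
Qed.

Section RepresentationBound.
Variables (R : realType) (E T : cstarAlgType R) (S : set E).
Hypothesis S_sqrt : forall h z, S h -> z^# = z ->
  (forall c, c ** h = h -> c ** z = z) -> S z.
Hypothesis SZ : forall (c : R) h, S h -> S (c%:C *: h).
Variables (L Q : E -> T) (y : T).
Hypothesis LZ : forall (c : R[i]) e, L (c *: e) = c *: L e.
Hypothesis QD : forall e e', Q (e + e') = Q e + Q e'.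
Hypothesis LL : forall e e', S e -> S e' -> (L e)^# ** L e' = Q (e^# ** e').
Hypothesis yL : forall e, S e -> y^# ** L e = Q e.
Hypothesis Ly : forall e, S e -> (L e)^# ** y = Q e^#.

(* [L e] stands for [e y], where [e] acts on the left. *)
Lemma representation_bound h : S h -> h^# = h -> nrm (L h) <= 2 * nrm h * nrm y.
Proof.
move=> Sh hs; have [->|h0] := eqVneq h 0.
  by rewrite nrm0 mulr0 mul0r -(scale0r (0 : E)) LZ scale0r nrm0.
(* Scaling [h] to norm 1/2 makes [sqrt_one_minus_sqr] applicable; this is the origin of the factor 2
   in the bound. *)
have hp := nrm_gt0 h0; pose c : R := (2 * nrm h)^-1.
have cp : 0 < c by rewrite invr_gt0 mulr_gt0.
have gs : (c%:C *: h)^# = c%:C *: h by rewrite cstarZ hs conjR.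
have ng : nrm (c%:C *: h) = 2^-1.
  by rewrite nrmZR gtr0_norm// /c; field; rewrite gt_eqF.
suff : nrm (L (c%:C *: h)) <= nrm y.
  rewrite LZ nrmZR gtr0_norm// /c ler_pdivrMl ?mulr_gt0//.
have Sg := SZ c Sh; move: (c%:C *: h) gs ng Sg => g gs ng Sg.
have [|z [zs gz zE zc]] := sqrt_one_minus_sqr gs; first by rewrite ng.
have Sz : S z by apply: S_sqrt Sg zs _ => d; exact: zc.
rewrite -(@ler_pXn2r _ 2) ?nnegrE ?nrm_ge0// -!nrm_star.
have Q0 : Q 0 = 0 by apply: (addrI (Q 0)); rewrite -QD !addr0.
(* With [Q e] standing for [y^# e y], this is [y^# (g^2 + (1 + z)^2) y], where
   [g^2 + (1 + z)^2 = 1]; the vector [y + L z] plays the role of [(1 + z) y]. *)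
have -> : y^# ** y = (L g)^# ** L g + (y + L z)^# ** (y + L z).
  rewrite cstarD cmulDl !cmulDr !LL// yL// Ly// gs zs.
  rewrite [_ + Q z + _]addrC addrCA addrA [RHS]addrC -!addrA -!QD.
  rewrite (_ : z + _ = 0) ?Q0 ?addr0// -[RHS]zE.
  by rewrite -!addrA addrC -!addrA; congr (_ + _); rewrite addrCA.
rewrite nrm_star; apply: nrm_le_sqr_sum.
by rewrite cstarD cmulDl cmulDr !LL// yL// Ly// gs zs gz.
Qed.

End RepresentationBound.

(** For self-adjoint [h], letting [f e] act on [y = f h] gives [|f h|^2 <= 2 |h| |f h|]. The general
    case follows from [h = a^# a]. The constant is not sharp: only continuity matters. *)
Lemma star_morphism_bound (R : realType) (A B : cstarAlgType R) (f : A -> B) a :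
  star_morphism f -> nrm (f a) <= 2 * nrm a.
Proof.
move=> [fl fM fs].
have f0 : f 0 = 0.
  apply: (addrI (f 0)); rewrite addr0.
  by have := fl 1 0 0; rewrite !scale1r addr0.
have fD x y : f (x + y) = f x + f y by rewrite -[x]scale1r fl !scale1r.
have fZ c x : f (c *: x) = c *: f x by rewrite -[c *: x]addr0 fl f0 addr0.
have self h : h^# = h -> nrm (f h) <= 2 * nrm h.
  move=> hs; have [->|fh0] := eqVneq (f h) 0.
    by rewrite nrm0 mulr_ge0 ?nrm_ge0.
  rewrite -(ler_pM2r (nrm_gt0 fh0)).
  have <- : nrm (f h ** f h) = nrm (f h) * nrm (f h).
    by rewrite -expr2 -nrm_star -fs hs.
  apply: (@representation_bound _ _ _ setT _ _ (fun e => f e ** f h)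
    (fun e => f h ** f e ** f h)) => //.
  - by move=> c e; rewrite fZ cmulZl.
  - by move=> e e'; rewrite fD cmulDr cmulDl.
  - by move=> e e' _ _; rewrite cstarM -!fs hs fM !cmulA.
  - by move=> e _; rewrite -fs hs cmulA.
  - by move=> e _; rewrite cstarM -!fs hs.
have := self (a^# ** a); rewrite cstarM cstarK fM fs !nrm_star => /(_ erefl).
by have := nrm_ge0 a; have := nrm_ge0 (f a); rewrite !expr2; nra.
Qed.

Section BilinearBound.
Variables (R : realType) (A B T : cstarAlgType R) (S : set B).
Hypothesis S_sqrt : forall h z, S h -> z^# = z ->
  (forall c, c ** h = h -> c ** z = z) -> S z.
Hypothesis SZ : forall (c : R) h, S h -> S (c%:C *: h).
Hypothesis SM : forall h k, S h -> S k -> S (h ** k).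
Hypothesis Sstar : forall h, S h -> S h^#.
Variable tau : A -> B -> T.
Hypothesis tauDl : forall a a' b, tau (a + a') b = tau a b + tau a' b.
Hypothesis tauDr : forall a b b', tau a (b + b') = tau a b + tau a b'.
Hypothesis tauZl : forall (c : R[i]) a b, tau (c *: a) b = c *: tau a b.
Hypothesis tauZr : forall (c : R[i]) a b, tau a (c *: b) = c *: tau a b.
Hypothesis tauM : forall a a' b b', S b -> S b' ->
  tau a b ** tau a' b' = tau (a ** a') (b ** b').
Hypothesis taus : forall a b, S b -> (tau a b)^# = tau a^# b^#.

(* For self-adjoint [a] and [b], two one-sided bounds give
   [|tau a b|^2 = |tau a^2 b^2| <= 4 |a| |b| |tau a b|]. *)
Lemma bilinear_bound a b : S b -> nrm (tau a b) <= 2 * nrm a * nrm b.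
Proof.
have tausM c c' d d' : S d -> S d' ->
    (tau c d)^# ** tau c' d' = tau (c^# ** c') (d^# ** d').
  by move=> Sd Sd'; rewrite taus// tauM//; exact: Sstar.
have bl (h : A) a' b' : h^# = h -> S b' ->
    nrm (tau (h ** a') b') <= 2 * nrm h * nrm (tau a' b').
  move=> hs Sb; apply: (@representation_bound _ _ _ setT _ _
    (fun e => tau (e ** a') b') (fun e => tau (a'^# ** e ** a') (b'^# ** b')))
    => // [c e|e e'|e e' _ _|e _|e _].
  - by rewrite cmulZl tauZl.
  - by rewrite cmulDr cmulDl tauDl.
  - by rewrite tausM// cstarM !cmulA.
  - by rewrite tausM// cmulA.
  - by rewrite tausM// cstarM.
have br (h : B) a' b' : h^# = h -> S h -> S b' ->
    nrm (tau a' (h ** b')) <= 2 * nrm h * nrm (tau a' b').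
  move=> hs Sh Sb; apply: (@representation_bound _ _ _ S _ _
    (fun e => tau a' (e ** b')) (fun e => tau (a'^# ** a') (b'^# ** e ** b')))
    => // [c e|e e'|e e' Se Se'|e Se|e Se].
  - by rewrite cmulZl tauZr.
  - by rewrite cmulDr cmulDl tauDr.
  - by rewrite tausM; [rewrite cstarM !cmulA | exact: SM | exact: SM].
  - by rewrite tausM; [rewrite cmulA | | exact: SM].
  - by rewrite tausM; [rewrite cstarM | exact: SM | ].
have self a' b' : a'^# = a' -> b'^# = b' -> S b' ->
    nrm (tau a' b') <= 4 * nrm a' * nrm b'.
  move=> a's b's Sb.
  have := bl a' a' (b' ** b') a's (SM Sb Sb); have := br b' a' b' b's Sb Sb.
  have -> : nrm (tau (a' ** a') (b' ** b')) = nrm (tau a' b') ^+ 2.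
    by rewrite -tauM// -nrm_star taus// a's b's.
  have [->|t0] := eqVneq (nrm (tau a' b')) 0.
    by rewrite !mulr_ge0 ?nrm_ge0.
  have tp : 0 < nrm (tau a' b') by rewrite lt_neqAle eq_sym t0 nrm_ge0.
  move=> b1 b2; rewrite -(ler_pM2r tp) -expr2; apply: le_trans b2 _.
  rewrite (_ : 4 * nrm a' * nrm b' * _ =
    2 * nrm a' * (2 * nrm b' * nrm (tau a' b'))); last by ring.
  by rewrite ler_wpM2l// mulr_ge0// nrm_ge0.
(* By the C*-identity the square of the norm of [tau a b] is bounded by [4 |a|^2 |b|^2]; the
   constant 4 becomes its square root. *)
move=> Sb; have := self (a^# ** a) (b^# ** b).
rewrite -tausM// !cstarM !cstarK !nrm_star.
move=> /(_ erefl erefl (SM (Sstar Sb) Sb)).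
have := nrm_ge0 a; have := nrm_ge0 b; have := nrm_ge0 (tau a b).
move: (nrm a) (nrm b) (nrm _) => x y z z0 y0 x0 zxy.
rewrite -(@ler_pXn2r _ 2) ?nnegrE ?mulr_ge0// !exprMn.
by rewrite (_ : 2 ^+ 2 = 4 :> R)// -natrX.
Qed.

End BilinearBound.

(** * Extension by density *)

Section LinearMaps.
Variables (R : realType) (U V : lmodType R[i]) (f : U -> V).
Hypothesis lf : linear f.

Lemma lin0 : f 0 = 0.
Proof. by apply: (addrI (f 0)); have := lf 1 0 0; rewrite !scale1r !addr0. Qed.

Lemma linD x y : f (x + y) = f x + f y.
Proof. by rewrite -[x]scale1r lf !scale1r. Qed.

Lemma linZ c x : f (c *: x) = c *: f x.
Proof. by rewrite -[c *: x]addr0 lf lin0 addr0. Qed.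

Lemma linB x y : f (x - y) = f x - f y.
Proof. by rewrite linD -scaleN1r linZ scaleN1r. Qed.

Lemma lin_sum (I : Type) (r : seq I) (P : pred I) (F : I -> U) :
  f (\sum_(i <- r | P i) F i) = \sum_(i <- r | P i) f (F i).
Proof. by apply: (big_morph f linD); exact: lin0. Qed.

End LinearMaps.

Section Lipschitz.
Variable R : realType.
Implicit Types U V W : normedModType R[i].

Definition lip U V (f : U -> V) :=
  exists2 L : R, 0 <= L & forall x y, nrm (f x - f y) <= L * nrm (x - y).

Lemma lip_linear U V (f : U -> V) (L : R) : linear f -> 0 <= L ->
  (forall x, nrm (f x) <= L * nrm x) -> lip f.
Proof. by move=> lf L0 fL; exists L => // x y; rewrite -linB. Qed.

Lemma lip_comp U V W (f : V -> W) (g : U -> V) : lip f -> lip g -> lip (f \o g).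
Proof.
move=> [L L0 fL] [M M0 gM]; exists (L * M); first exact: mulr_ge0.
by move=> x y; apply: le_trans (fL _ _) _; rewrite -mulrA ler_wpM2l.
Qed.

Lemma lip_cst U V (a : V) : lip (fun _ : U => a).
Proof. by exists 0 => // x y; rewrite subrr nrm0 mul0r. Qed.

Lemma lip_id U : lip (@id U).
Proof. by exists 1 => // x y; rewrite mul1r. Qed.

Lemma lipD U V (f g : U -> V) : lip f -> lip g -> lip (fun x => f x + g x).
Proof.
move=> [L L0 fL] [M M0 gM]; exists (L + M); first exact: addr_ge0.
move=> x y; rewrite opprD addrACA mulrDl.
exact: le_trans (nrmD _ _) (lerD (fL _ _) (gM _ _)).
Qed.

Lemma lipZ U V (f : U -> V) (c : R[i]) : lip f -> lip (fun x => c *: f x).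
Proof.
move=> [L L0 fL]; have c0 := normc_nneg c.
exists (normc c * L); first exact: mulr_ge0.
by move=> x y; rewrite -scalerBr nrmZ -mulrA ler_wpM2l.
Qed.

Lemma lip_cmull U (A : cstarAlgType R) (f : U -> A) (a : A) : lip f ->
  lip (fun x => a ** f x).
Proof.
move=> [L L0 fL]; exists (nrm a * L); first by rewrite mulr_ge0 ?nrm_ge0.
move=> x y; rewrite -cmulBr; apply: le_trans (nrmM _ _) _.
by rewrite -mulrA ler_wpM2l ?nrm_ge0.
Qed.

Lemma lip_cmulr U (A : cstarAlgType R) (f : U -> A) (a : A) : lip f ->
  lip (fun x => f x ** a).
Proof.
move=> [L L0 fL]; exists (nrm a * L); first by rewrite mulr_ge0 ?nrm_ge0.
move=> x y; rewrite -cmulBl; apply: le_trans (nrmM _ _) _.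
by rewrite mulrC -mulrA ler_wpM2l ?nrm_ge0.
Qed.

Lemma lip_cstar U (A : cstarAlgType R) (f : U -> A) : lip f ->
  lip (fun x => (f x)^#).
Proof.
move=> [L L0 fL]; exists L => // x y.
by rewrite -cstarB nrm_cstar.
Qed.

Lemma lip_near_eq U V (f g : U -> V) (D : set U) x : lip f -> lip g ->
  (forall y, D y -> f y = g y) -> near_set D x -> f x = g x.
Proof.
move=> [L L0 fL] [M M0 gM] fg Dx; apply/subr0_eq/nrm_le_eps => e e0.
have LM : 0 < L + M + 1 by lra.
have [y /fg fgy xy] := Dx (e / (L + M + 1)) ltac:(by rewrite divr_gt0).
apply: le_trans (nrm_tri (f y) _ _) _; rewrite {2}fgy (nrmBC (g y)).
apply: (@le_trans _ _ ((L + M + 1) * nrm (x - y))).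
  by have := fL x y; have := gM x y; have := nrm_ge0 (x - y); lra.
by rewrite mulrC -ler_pdivlMr// ltW.
Qed.

Lemma near_set_sum U (I : Type) (s : seq I) (F : I -> U) (S : set U) :
  S 0 -> (forall x y, S x -> S y -> S (x + y)) ->
  (forall i, near_set S (F i)) -> near_set S (\sum_(i <- s) F i).
Proof.
move=> S0 SD SF; elim: s => [|i s IH] e e0.
  by exists 0 => //; rewrite big_nil subrr nrm0.
have [y Sy xy] := IH (e / 2) ltac:(by rewrite divr_gt0).
have [z Sz xz] := SF i (e / 2) ltac:(by rewrite divr_gt0).
exists (z + y); first exact: SD.
by rewrite big_cons opprD addrACA; apply: le_lt_trans (nrmD _ _) _; lra.
Qed.

Lemma near_set_trans U (S S' : set U) x : near_set S x ->
  (forall y, S y -> near_set S' y) -> near_set S' x.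
Proof.
move=> Sx SS e e0; have [y Sy xy] := Sx (e / 2) ltac:(by rewrite divr_gt0).
have [z Sz yz] := SS y Sy (e / 2) ltac:(by rewrite divr_gt0).
by exists z => //; apply: le_lt_trans (nrm_tri y _ _) _; lra.
Qed.

Lemma near_set_refl U (S : set U) x : S x -> near_set S x.
Proof. by move=> Sx e e0; exists x => //; rewrite subrr nrm0. Qed.

(* [F] is the closure of the graph [G]. *)
Lemma extend_bounded (U : normedModType R[i]) (V : completeNormedModType R[i])
  (G : U -> V -> Prop) (L : R) : 0 <= L ->
  (forall x y, G x y -> nrm y <= L * nrm x) ->
  (forall c x y x' y', G x y -> G x' y' -> G (c *: x + x') (c *: y + y')) ->
  (forall x, near_set [set x | exists y, G x y] x) ->
  exists F : U -> V, [/\ linear F, forall x, nrm (F x) <= L * nrm x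
    & forall x y, G x y -> F x = y].
Proof.
move=> L0 GL GD GU.
pose H x y := forall e : R, 0 < e -> exists x' y',
  [/\ G x' y', nrm (x - x') < e & nrm (y - y') < e].
(* [G] is a relation because its arguments will be given by finite sums that are not unique.
   Differences stay in [G], so the bound alone makes [G], and then its closure [H],
   single-valued. *)
have GB x y x' y' : G x y -> G x' y' -> nrm (y - y') <= L * nrm (x - x').
  move=> Gxy Gxy'; have := GL _ _ (GD (-1) _ _ _ _ Gxy' Gxy).
  by rewrite !scaleN1r ![- _ + _]addrC.
have HH x y y' : H x y -> H x y' -> y = y'.
  move=> Hy Hy'; apply/subr0_eq/nrm_le_eps => e e0.
  have d0 : 0 < e / (2 * (L + 1)) by rewrite divr_gt0//; lra.
  have [a [b [Gab xa yb]]] := Hy _ d0; have [c [d [Gcd xc yd]]] := Hy' _ d0.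
  have h1 := GB _ _ _ _ Gab Gcd.
  have h2 := nrm_tri x a c; rewrite (nrmBC a x) in h2.
  have h3 := nrm_tri b y y'; have h4 := nrm_tri d b y'.
  rewrite (nrmBC d) in h4.
  have h5 : e = (2 * (L + 1)) * (e / (2 * (L + 1))).
    by field; rewrite gt_eqF//; lra.
  set t := e / _ in d0 xa yb xc yd h5; rewrite h5.
  have : L * nrm (a - c) <= L * (2 * t) by rewrite ler_wpM2l//; lra.
  by nra.
have Hex x : exists y, H x y.
  have [u Gu] : {u : nat -> U * V & forall n, G (u n).1 (u n).2 /\
      nrm (x - (u n).1) < 2^-1 ^+ n}.
    apply: (@choice _ _ (fun n v => G v.1 v.2 /\ nrm (x - v.1) < 2^-1 ^+ n)) => n.
    have [|y [z Gyz] xy] := GU x (2^-1 ^+ n); last by exists (y, z).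
    by rewrite exprn_gt0// invr_gt0.
  have half (n m : nat) : (n <= m)%N -> (2^-1 : R) ^+ m <= 2^-1 ^+ n.
    by move=> nm; apply: ler_wiXn2l; rewrite ?invr_ge0// invf_le1 ?ler1n.
  have [y uy] : exists y, tends (fun n => (u n).2) y.
    apply: complete_nrm => e e0.
    have d0 : 0 < e / (2 * (L + 1)) by rewrite divr_gt0//; lra.
    have [N Ne] := half_expn_lt d0; exists N => m n Nm Nn.
    have [Gm xm] := Gu m; have [Gn xn] := Gu n.
    apply: le_lt_trans (GB _ _ _ _ Gm Gn) _.
    have := nrm_tri x (u m).1 (u n).1; rewrite (nrmBC _ x).
    have := half _ _ Nm; have := half _ _ Nn.
    have h5 : e = (2 * (L + 1)) * (e / (2 * (L + 1))).
      by field; rewrite gt_eqF//; lra.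
    set t := e / _ in Ne d0 h5; rewrite h5 => h1 h2 h3.
    have : L * nrm ((u m).1 - (u n).1) <= L * (2 * t) by rewrite ler_wpM2l//; lra.
    by nra.
  exists y => e e0; have [N Ny] := uy _ e0; have [M Me] := half_expn_lt e0.
  have [Gk xk] := Gu (maxn N M); exists (u (maxn N M)).1, (u (maxn N M)).2.
  split=> //; last by rewrite nrmBC Ny// leq_maxl.
  exact: lt_trans xk (le_lt_trans (half _ _ (leq_maxr _ _)) Me).
have [F HF] := choice Hex.
exists F; split.
- move=> c x x'; apply: (HH (c *: x + x')); first exact: HF.
  move=> e e0; have c0 := normc_nneg c.
  have d0 : 0 < e / (2 * (normc c + 1)) by rewrite divr_gt0//; lra.
  have e20 : 0 < e / 2 by rewrite divr_gt0.
  have [a [b [Gab xa Fb]]] := HF x _ d0.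
  have [a' [b' [Gab' xa' Fb']]] := HF x' _ e20.
  have h5 : e / 2 = (normc c + 1) * (e / (2 * (normc c + 1))).
    by field; rewrite gt_eqF//; lra.
  set t := e / (2 * _) in d0 xa Fb h5.
  exists (c *: a + a'), (c *: b + b'); split; first exact: GD.
    rewrite opprD addrACA -scalerBr; apply: le_lt_trans (nrmD _ _) _.
    rewrite nrmZ; have : normc c * nrm (x - a) <= normc c * t by rewrite ler_wpM2l// ltW.
    by lra.
  rewrite opprD addrACA -scalerBr; apply: le_lt_trans (nrmD _ _) _.
  rewrite nrmZ; have : normc c * nrm (F x - b) <= normc c * t by rewrite ler_wpM2l// ltW.
  by lra.
- move=> x; apply/ler_addgt0Pr => e e0.
  have d0 : 0 < e / (L + 1) by rewrite divr_gt0//; lra.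
  have [a [b [Gab xa Fb]]] := HF x _ d0.
  have h5 : e = (L + 1) * (e / (L + 1)) by field; rewrite gt_eqF//; lra.
  set t := e / _ in d0 xa Fb h5; rewrite h5.
  have := GL _ _ Gab; have := nrmB_ge (F x) b; have := nrmB_ge a x.
  rewrite (nrmBC a) => h1 h2 h3.
  have : L * nrm a <= L * (nrm x + t) by rewrite ler_wpM2l//; lra.
  by lra.
- move=> x y Gxy; apply: (HH x); first exact: HF.
  by move=> e e0; exists x, y; rewrite !subrr !nrm0.
Qed.

End Lipschitz.

(** * Matrix units *)

Section MatrixUnits.
Variables (R : realType) (K : cstarAlgType R).

Definition corner_unit (p : nat -> nat -> K) n : K := \sum_(i < n) p i i.

(** All that is used of the compact operators: one-dimensional corners, approximation by finite
    matrices, and, in [mx_unit_pos], the squared length of the vector [a e_0] as the coefficient of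
    [p 0 0]. *)
Record matrix_units (p : nat -> nat -> K) : Prop := MatrixUnits {
  mx_unitM : forall i j k l, p i j ** p k l = if j == k then p i l else 0;
  mx_unit_star : forall i j, (p i j)^# = p j i;
  mx_unit_nrm : nrm (p 0 0) = 1;
  mx_unit_scalar : forall a i j, exists c : R[i], p i i ** a ** p j j = c *: p i j;
  mx_unit_dense : forall a (e : R), 0 < e ->
    exists n, nrm (a - corner_unit p n ** a ** corner_unit p n) < e;
  mx_unit_pos : forall a,
    p 0 0 ** a^# ** a ** p 0 0 = (nrm (a ** p 0 0) ^+ 2)%:C *: p 0 0
}.

Variable p : nat -> nat -> K.
Hypothesis pu : matrix_units p.

Local Notation q := (corner_unit p).

Lemma mx_unit_neq0 i j : p i j != 0.
Proof.
apply/eqP => pij; have : p 0 0 = 0.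
  have -> : p 0 0 = p 0 i ** p i j ** p j 0.
    by rewrite !(mx_unitM pu) eqxx (mx_unitM pu) eqxx.
  by rewrite pij cmul0r cmul0l.
by move=> p00; have := mx_unit_nrm pu; rewrite p00 nrm0 => /eqP; rewrite eq_sym oner_eq0.
Qed.

Definition entry (a : K) i j : R[i] := xget 0 [set c | p i i ** a ** p j j = c *: p i j].

Lemma entryE a i j : p i i ** a ** p j j = entry a i j *: p i j.
Proof.
have [c ac] := mx_unit_scalar pu a i j.
by rewrite /entry; case: xgetP => [d _ //|/(_ c)].
Qed.

Lemma entry_unique a i j c : p i i ** a ** p j j = c *: p i j -> entry a i j = c.
Proof.
rewrite entryE => /eqP; rewrite -subr_eq0 -scalerBl scaler_eq0.
by rewrite (negPf (mx_unit_neq0 i j)) orbF subr_eq0 => /eqP.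
Qed.

Lemma entry_linear i j : linear (fun a => entry a i j : R[i]^o).
Proof.
move=> c a b; apply: entry_unique.
by rewrite cmulDr cmulDl cmulZr cmulZl !entryE scalerA -scalerDl.
Qed.

Lemma entry_star a i j : entry a^# i j = (entry a j i)^*.
Proof.
apply: entry_unique.
have := congr1 (@cstar _ K) (entryE a j i).
by rewrite !cstarM cstarZ !(mx_unit_star pu) cmulA.
Qed.

Lemma corner_unit_star n : (q n)^# = q n.
Proof. by rewrite cstar_sum; apply: eq_bigr => i _; rewrite (mx_unit_star pu). Qed.

Lemma mx_unit_corner n i : p i i ** q n = if (i < n)%N then p i i else 0.
Proof.
rewrite /corner_unit cmul_sumr; case: ltnP => [lt_in|le_ni].
  rewrite (bigD1 (Ordinal lt_in)) //= (mx_unitM pu) eqxx big1 ?addr0// => j ji.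
  by rewrite (mx_unitM pu) ifN// eq_sym; apply: contra ji => /eqP ji; apply/eqP/val_inj.
by rewrite big1// => j _; rewrite (mx_unitM pu) ifN// gtn_eqF// (leq_trans (ltn_ord j)).
Qed.

Lemma corner_mx_unit n i : q n ** p i i = if (i < n)%N then p i i else 0.
Proof.
rewrite -[LHS]cstarK cstarM corner_unit_star (mx_unit_star pu) mx_unit_corner.
by case: ifP => _; rewrite ?cstar0// (mx_unit_star pu).
Qed.

Lemma corner_unitM m n : (m <= n)%N -> q m ** q n = q m.
Proof.
move=> mn; rewrite {1}/corner_unit cmul_suml; apply: eq_bigr => i _.
by rewrite mx_unit_corner (leq_trans (ltn_ord i)).
Qed.

Definition corner n (k : K) := q n ** k = k /\ k ** q n = k.

Lemma corner_le m n k : (m <= n)%N -> corner m k -> corner n k.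
Proof.
move=> mn [qk kq]; split; last by rewrite -kq -cmulA corner_unitM.
rewrite -qk cmulA -[q n ** _]cstarK cstarM !corner_unit_star corner_unitM//.
by rewrite corner_unit_star.
Qed.

Lemma corner_compress n k : corner n (q n ** k ** q n).
Proof. by split; rewrite -?cmulA ?corner_unitM// !cmulA corner_unitM. Qed.

Lemma corner_near k : near_set [set k | exists n, corner n k] k.
Proof.
move=> e /(mx_unit_dense pu k)[n kn]; exists (q n ** k ** q n) => //.
by exists n; exact: corner_compress.
Qed.

Lemma corner_star n k : corner n k -> corner n k^#.
Proof. by move=> [qk kq]; split; rewrite -[q n]corner_unit_star -cstarM ?qk ?kq. Qed.

Lemma cornerM n h k : corner n h -> corner n k -> corner n (h ** k).
Proof. by move=> [qh hq] [qk kq]; split; rewrite ?cmulA ?qh// -cmulA kq. Qed.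

Lemma corner_linear n (c : R[i]) h k : corner n h -> corner n k ->
  corner n (c *: h + k).
Proof.
move=> [qh hq] [qk kq]; split.
  by rewrite cmulDr cmulZr qh qk.
by rewrite cmulDl cmulZl hq kq.
Qed.

Lemma corner0 n : corner n 0.
Proof. by split; rewrite ?cmul0l ?cmul0r. Qed.

(** The corner unit is a left unit of [h], hence of [z]; it is also a right unit because [z] is
    self-adjoint. So corners are closed under the square roots of [sqrt_one_minus_sqr]. *)
Lemma corner_sqrt n h z : corner n h -> z^# = z ->
  (forall c, c ** h = h -> c ** z = z) -> corner n z.
Proof.
move=> [qh _] zs hz; have qz := hz _ qh; split=> //.
by rewrite -[LHS]cstarK cstarM corner_unit_star zs qz.
Qed.

Lemma cornerE n k : corner n k ->
  k = \sum_(i < n) \sum_(j < n) entry k i j *: p i j.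
Proof.
move=> [qk kq]; rewrite -{1}kq -{1}qk /corner_unit cmul_suml cmul_suml.
apply: eq_bigr => i _; rewrite cmul_sumr; apply: eq_bigr => j _.
exact: entryE.
Qed.

Lemma entry_out n k i j : corner n k -> (n <= i)%N || (n <= j)%N -> entry k i j = 0.
Proof.
move=> [qk kq] nij; apply: entry_unique; rewrite scale0r.
case/orP: nij => [ni|nj].
  by rewrite -qk !cmulA mx_unit_corner ltnNge ni !cmul0l.
by rewrite -kq -!cmulA corner_mx_unit ltnNge nj !cmul0r.
Qed.

Lemma entryM n h k i l : corner n h -> entry (h ** k) i l =
  \sum_(j < n) entry h i j * entry k j l.
Proof.
move=> [_ hq]; apply: entry_unique; rewrite -{1}hq scaler_suml.
rewrite /corner_unit cmul_sumr cmul_suml cmul_sumr cmul_suml.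
apply: eq_bigr => j _.
have -> : p i i ** (h ** p j j ** k) ** p l l =
    (p i i ** h ** p j j) ** (p j j ** k ** p l l).
  by rewrite !cmulA -[_ ** p j j ** p j j]cmulA (mx_unitM pu) eqxx.
by rewrite !entryE cmulZl cmulZr (mx_unitM pu) eqxx scalerA.
Qed.

(** The finite compressions of [k] vanish, and they approximate [k]. *)
Lemma entry_eq0 k : (forall i j, entry k i j = 0) -> k = 0.
Proof.
move=> k0; apply: nrm_le_eps => e e0; have [n kn] := mx_unit_dense pu k e0.
apply: ltW; move: kn; rewrite (cornerE (corner_compress n k)) big1 ?subr0// => i _.
rewrite big1// => j _; rewrite (_ : entry _ i j = 0) ?scale0r//.
apply: entry_unique; rewrite !cmulA mx_unit_corner ltn_ord -!cmulA.
by rewrite corner_mx_unit ltn_ord !cmulA entryE k0.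
Qed.

Lemma corner_mx_unit_ij i j n : (i < n)%N -> (j < n)%N -> corner n (p i j).
Proof.
move=> lt_in lt_jn; have pii : p i i ** p i j = p i j.
  by rewrite (mx_unitM pu) eqxx.
have pjj : p i j ** p j j = p i j by rewrite (mx_unitM pu) eqxx.
by split; [rewrite -pii cmulA corner_mx_unit | rewrite -pjj -cmulA mx_unit_corner];
  rewrite ?lt_in ?lt_jn.
Qed.

Lemma entry_mx_unit i j k l :
  entry (p i j) k l = if (k == i) && (l == j) then 1 else 0.
Proof.
apply: entry_unique; rewrite (mx_unitM pu).
case: eqP => [->|_] /=; last by rewrite cmul0l scale0r.
rewrite (mx_unitM pu) eq_sym; case: eqP => [->|_]; rewrite ?scale1r ?scale0r//.
Qed.

End MatrixUnits.

(** * Matrix systems *)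

Section MatrixSystem.
Variables (R : realType) (C : cstarAlgType R) (B : Type).
Variable m : B -> nat -> nat -> C.

Definition block_sum (s t : nat -> nat) (r : seq (B * (nat * nat))) : C :=
  \sum_(e <- r) m e.1 (s e.2.1) (t e.2.2).

(* [m b k l] stands for [b (x) e_kl], the [B] being a *-algebra: a matrix
   system exhibits a dense *-subalgebra of [S] of the form [B (x) M_oo]. *)
Record matrix_system (S : set C) (scl : R[i] -> B -> B) (mul : B -> B -> B)
    (str : B -> B) : Prop := MatrixSystem {
  ms_in : forall b k l, S (m b k l);
  msZ : forall c b k l, m (scl c b) k l = c *: m b k l;
  msM : forall b k l b' k' l', m b k l ** m b' k' l' =
    if l == k' then m (mul b b') k l' else 0;
  ms_star : forall b k l, (m b k l)^# = m (str b) l k;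
  ms_dense : S `<=` near_set [set x | exists r, x = block_sum id id r]
}.

End MatrixSystem.

(** The type [B] has no addition and its operations obey no laws: they matter only through [m], and
    sums are lists. This leaves room for [option B] and [B * evconst] as new coefficients. *)
Definition matricial (R : realType) (C : cstarAlgType R) (S : set C) :=
  exists (B : Type) (m : B -> nat -> nat -> C) scl mul str,
    matrix_system m S scl mul str.

Section Compressions.
Variables (R : realType) (C : cstarAlgType R) (B : Type).
Variables (m : B -> nat -> nat -> C) (scl : R[i] -> B -> B) (mul : B -> B -> B).
Variable str : B -> B.
Hypothesis ms : matrix_system m setT scl mul str.

Local Notation bsum := (block_sum m).

Lemma block_sum_cat s t r r' : bsum s t (r ++ r') = bsum s t r + bsum s t r'.
Proof. by rewrite /block_sum big_cat. Qed.

Lemma block_sumZ s t c r :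
  bsum s t [seq (scl c e.1, e.2) | e <- r] = c *: bsum s t r.
Proof.
by rewrite /block_sum big_map scaler_sumr; apply: eq_bigr => e _; rewrite (msZ ms).
Qed.

Lemma block_sum_star s t r :
  (bsum s t r)^# = bsum t s [seq (str e.1, (e.2.2, e.2.1)) | e <- r].
Proof.
by rewrite /block_sum big_map cstar_sum; apply: eq_bigr => e _; rewrite (ms_star ms).
Qed.

Definition block_mul (r r' : seq (B * (nat * nat))) :=
  flatten [seq [seq (mul e.1 e'.1, (e.2.1, e'.2.2)) | e' <- r' & e.2.2 == e'.2.1]
    | e <- r].

(** The hypothesis says that [t] and [s'] are the same injection if [d] holds, and have disjoint
    ranges otherwise. *)
Lemma block_sumM s t s' t' r r' (d : bool) :
  (forall k l, (t k == s' l) = d && (k == l)) ->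
  bsum s t r ** bsum s' t' r' = if d then bsum s t' (block_mul r r') else 0.
Proof.
move=> ts; transitivity (\sum_(e <- r) \sum_(e' <- r')
    if d && (e.2.2 == e'.2.1) then m (mul e.1 e'.1) (s e.2.1) (t' e'.2.2) else 0).
  rewrite /block_sum cmul_suml; apply: eq_bigr => e _.
  by rewrite cmul_sumr; apply: eq_bigr => e' _; rewrite (msM ms) ts.
case: d {ts} => /=; last by rewrite big1// => e _; rewrite big1.
rewrite /block_sum big_flatten big_map; apply: eq_bigr => e _.
by rewrite big_map big_filter [RHS]big_mkcond.
Qed.

(* [x^* x] forgets the row indices and [x x^*] the column indices. *)
Lemma nrm_block_sum s t s' t' r : injective s -> injective t ->
  injective s' -> injective t' -> nrm (bsum s t r) = nrm (bsum s' t' r).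
Proof.
move=> si ti si' ti'.
have rows u v w : injective u -> injective v ->
    nrm (bsum u w r) = nrm (bsum v w r).
  move=> ui vi; apply/eqP; rewrite -(@eqrXn2 _ 2) ?nrm_ge0//.
  rewrite -!nrm_star !block_sum_star.
  rewrite (@block_sumM _ u u _ _ _ true) => [|k l]; last exact: inj_eq.
  by rewrite (@block_sumM _ v v _ _ _ true) => // k l; exact: inj_eq.
rewrite (rows s s')//; apply/eqP; rewrite -(@eqrXn2 _ 2) ?nrm_ge0//.
rewrite -!nrm_starr !block_sum_star.
rewrite (@block_sumM _ t t _ _ _ true) => [|k l]; last exact: inj_eq.
by rewrite (@block_sumM _ t' t' _ _ _ true) => // k l; exact: inj_eq.
Qed.

End Compressions.

Lemma nat_pairing : exists pr : nat -> nat -> nat,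
  (forall i k j l, (pr i k == pr j l) = (i == j) && (k == l)) /\
  forall n, exists i k, n = pr i k.
Proof.
have /card_set_bijP[f [_ finj fsurj]] := card_nat2.
exists (fun i k => f (i, k)); split=> [i k j l|n].
  apply/eqP/andP => [/finj|[/eqP-> /eqP->]//].
  by rewrite !inE => /(_ I I)[-> ->].
by have [[i k] _ <-] := fsurj n I; exists i, k.
Qed.

(* [M i j] is [x |-> v_i x v_j^*] for isometries [v_i] with orthogonal ranges
   adding up to the unit. *)
Record compression_system (R : realType) (C : cstarAlgType R)
    (M : nat -> nat -> C -> C) : Prop := CompressionSystem {
  cs_linear : forall i j, linear (M i j);
  cs_nrm : forall i j x, nrm (M i j x) = nrm x;
  csM : forall i j k l x y, M i j x ** M k l y = if j == k then M i l (x ** y) else 0;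
  cs_star : forall i j x, (M i j x)^# = M j i x^#;
  cs_dense : forall x, near_set
    [set y | exists r : seq (C * (nat * nat)),
      y = \sum_(e <- r) M e.2.1 e.2.2 e.1] x
}.

Lemma matricial_compression (R : realType) (C : cstarAlgType R) :
  matricial [set: C] -> exists M, @compression_system R C M.
Proof.
move=> [B [m [scl [mul [str ms]]]]].
have [pr [prE pr_surj]] := nat_pairing.
have pri i : injective (pr i).
  by move=> k l /eqP; rewrite prE eqxx => /eqP.
have idi : injective (@id nat) by [].
pose D := [set x | exists r, x = block_sum m id id r].
have DT x : near_set D x by exact: (ms_dense ms).
have {pri} prn i j r : nrm (block_sum m (pr i) (pr j) r) = nrm (block_sum m id id r).
  exact: (nrm_block_sum ms).
have Mex (ij : nat * nat) : exists F : C -> C, [/\ linear F,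
    forall x, nrm (F x) <= 1 * nrm x
    & forall r, F (block_sum m id id r) = block_sum m (pr ij.1) (pr ij.2) r].
  have [||c x y x' y'|x|F [lF bF FE]] := @extend_bounded R C C (fun x y => exists r,
    x = block_sum m id id r /\ y = block_sum m (pr ij.1) (pr ij.2) r) 1.
  - by [].
  - by move=> x y [r [-> ->]]; rewrite prn mul1r.
  - move=> [r [-> ->]] [r' [-> ->]].
    exists ([seq (scl c e.1, e.2) | e <- r] ++ r').
    by rewrite !block_sum_cat !(block_sumZ ms).
  - move=> e /(DT x)[y [r yr] xy]; exists y => //.
    by exists (block_sum m (pr ij.1) (pr ij.2) r), r.
  by exists F; split=> // r; apply: FE; exists r.
have [M0 M0P] := choice Mex; pose M i j := M0 (i, j).
have Ml i j : linear (M i j) by have [] := M0P (i, j).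
have Mb i j x : nrm (M i j x) <= 1 * nrm x by have [_ + _] := M0P (i, j); exact.
have ME i j r : M i j (block_sum m id id r) = block_sum m (pr i) (pr j) r.
  by have [_ _] := M0P (i, j); exact.
have Mlip i j : lip (M i j) by apply: (@lip_linear _ _ _ _ 1).
exists M; split=> //.
- move=> i j x; apply/eqP; rewrite eq_le.
  have := Mb i j x; rewrite mul1r => -> /=; apply/ler_addgt0Pr => e e0.
  have [|y [r yr] xy] := DT x (e / 2); first by rewrite divr_gt0.
  have My : M i j y = block_sum m (pr i) (pr j) r by rewrite yr ME.
  have := Mb i j (x - y); have := nrmB_ge x y; rewrite linB// mul1r My.
  have := nrmB_ge (block_sum m (pr i) (pr j) r) (M i j x).
  by rewrite prn -yr nrmBC; lra.
- move=> i j k l x y.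
  have idM r r' : block_sum m id id r ** block_sum m id id r' =
      block_sum m id id (block_mul mul r r').
    exact: (@block_sumM _ _ _ _ _ _ _ ms id id id id r r' true).
  have mulE r r' : M i j (block_sum m id id r) ** M k l (block_sum m id id r') =
      if j == k then M i l (block_sum m id id r ** block_sum m id id r') else 0.
    rewrite !ME (@block_sumM _ _ _ _ _ _ _ ms _ _ _ _ _ _ (j == k)) => [|u v].
      by case: ifP => // _; rewrite idM ME.
    exact: prE.
  have lipif (f : C -> C) : lip f -> lip (fun z => if j == k then M i l (f z) else 0).
    by case: (j == k) => lf; [exact: (lip_comp (Mlip i l)) | exact: lip_cst].
  apply: (@lip_near_eq _ _ _ (fun z => M i j z ** M k l y)
    (fun z => if j == k then M i l (z ** y) else 0) D) (DT x).
  + exact: lip_cmulr.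
  + by apply: lipif; apply: lip_cmulr; exact: lip_id.
  + move=> _ [r ->]; apply: (@lip_near_eq _ _ _
      (fun z => M i j (block_sum m id id r) ** M k l z)
      (fun z => if j == k then M i l (block_sum m id id r ** z) else 0) D) (DT y).
    * exact: lip_cmull.
    * by apply: lipif; apply: lip_cmull; exact: lip_id.
    * by move=> _ [r' ->].
- move=> i j x; apply: (@lip_near_eq _ _ _ (fun z => (M i j z)^#)
    (fun z => M j i z^#) D) (DT x).
  + exact: lip_cstar.
  + by apply: (lip_comp (Mlip j i)); apply: lip_cstar; exact: lip_id.
  + by move=> _ [r ->]; rewrite (block_sum_star ms) !ME (block_sum_star ms).
- move=> x; apply: near_set_trans (DT x) _ => _ [r ->].
  apply: near_set_sum.
  + by exists [::]; rewrite big_nil.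
  + by move=> _ _ [r1 ->] [r2 ->]; exists (r1 ++ r2); rewrite big_cat.
  + move=> [b [k l]] /=; apply: near_set_refl.
    (* Every index is a pair, so [m b k l] is itself the image of some [m b k' l'] under a shift. *)
    have [i [k' ->]] := pr_surj k; have [j [l' ->]] := pr_surj l.
    exists [:: (m b k' l', (i, j))]; rewrite big_seq1 /=.
    have := ME i j [:: (b, (k', l'))].
    by rewrite /block_sum !big_seq1.
Qed.

(** * Matrix systems give stability *)

Section TensorProduct.
Variables (R : realType) (K C : cstarAlgType R) (p : nat -> nat -> K).
Variable M : nat -> nat -> C -> C.
Hypotheses (pu : matrix_units p) (cs : compression_system M).

(** The sum of all [k_ij v_i x v_j^*], the future image of [x (x) k] in [C]. *)
Definition corner_tensor n (x : C) (k : K) : C :=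
  \sum_(i < n) \sum_(j < n) entry p k i j *: M i j x.

Let entryD k k' i j : entry p (k + k') i j = entry p k i j + entry p k' i j.
Proof. exact: (linD (entry_linear pu i j)). Qed.

Let entryZ c k i j : entry p (c *: k) i j = c * entry p k i j.
Proof. exact: (linZ (entry_linear pu i j)). Qed.

Let ctDl n x x' k :
  corner_tensor n (x + x') k = corner_tensor n x k + corner_tensor n x' k.
Proof.
rewrite -big_split; apply: eq_bigr => i _; rewrite -big_split; apply: eq_bigr => j _.
by rewrite (linD (cs_linear cs i j)) scalerDr.
Qed.

Let ctDr n x k k' :
  corner_tensor n x (k + k') = corner_tensor n x k + corner_tensor n x k'.
Proof.
rewrite -big_split; apply: eq_bigr => i _; rewrite -big_split; apply: eq_bigr => j _.
by rewrite entryD scalerDl.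
Qed.

Let ctZl n (c : R[i]) x k : corner_tensor n (c *: x) k = c *: corner_tensor n x k.
Proof.
rewrite scaler_sumr; apply: eq_bigr => i _; rewrite scaler_sumr.
by apply: eq_bigr => j _; rewrite (linZ (cs_linear cs i j)) !scalerA mulrC.
Qed.

Let ctZr n (c : R[i]) x k : corner_tensor n x (c *: k) = c *: corner_tensor n x k.
Proof.
rewrite scaler_sumr; apply: eq_bigr => i _; rewrite scaler_sumr.
by apply: eq_bigr => j _; rewrite entryZ scalerA.
Qed.

Let ctM n x x' k k' : corner p n k -> corner p n k' ->
  corner_tensor n x k ** corner_tensor n x' k' = corner_tensor n (x ** x') (k ** k').
Proof.
move=> nk nk'; rewrite /corner_tensor cmul_suml; apply: eq_bigr => i _.
rewrite cmul_suml; under eq_bigr => j _.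
  rewrite cmul_sumr (bigD1 j) //= [X in _ + X]big1 ?addr0; last first.
    move=> j' jj'; rewrite cmul_sumr big1// => l _.
    by rewrite cmulZl cmulZr (csM cs) ifN ?scaler0// eq_sym.
  rewrite cmul_sumr; under eq_bigr => l _.
    rewrite cmulZl cmulZr (csM cs) eqxx scalerA; over.
  over.
rewrite exchange_big; apply: eq_bigr => l _ /=.
by rewrite (entryM pu k' i l nk) scaler_suml.
Qed.

Let ct_star n x k : corner p n k -> (corner_tensor n x k)^# = corner_tensor n x^# k^#.
Proof.
move=> nk; rewrite cstar_sum; under eq_bigr => i _ do rewrite cstar_sum.
rewrite exchange_big; apply: eq_bigr => i _; apply: eq_bigr => j _ /=.
by rewrite cstarZ (cs_star cs) (entry_star pu).
Qed.

Let ct_bound n x k : corner p n k -> nrm (corner_tensor n x k) <= 2 * nrm x * nrm k.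
Proof.
(* The map [corner_tensor n] is multiplicative on the corner only; this is why the bound was proved
   relative to a set [S]. *)
apply: (@bilinear_bound _ _ _ _ (corner p n)) => //.
- by move=> h z; exact: corner_sqrt.
- move=> c h nh; rewrite -[_ *: h]addr0; apply: corner_linear => //.
  exact: corner0.
- by move=> h h'; exact: cornerM.
- by move=> h; exact: corner_star.
- by move=> *; exact: ctM.
- by move=> *; exact: ct_star.
Qed.

Let ct_widen m n x k : (m <= n)%N -> corner p m k ->
  corner_tensor n x k = corner_tensor m x k.
Proof.
move=> mn mk.
have out i j : (m <= i)%N || (m <= j)%N -> entry p k i j *: M i j x = 0.
  by move=> mij; rewrite (entry_out pu mk mij) scale0r.
rewrite /corner_tensor -(big_mkord xpredT (fun i => \sum_(j < n) entry p k i j *: M i j x)).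
rewrite (big_cat_nat (leq0n m) mn)//= [X in _ + X]big_nat_cond.
rewrite [X in _ + X]big1 ?addr0; last first.
  by move=> i /andP[/andP[mi _] _]; rewrite big1// => j _; rewrite out ?mi.
rewrite big_mkord; apply: eq_bigr => i _.
rewrite -(big_mkord xpredT (fun j => entry p k i j *: M i j x)).
rewrite (big_cat_nat (leq0n m) mn)//= [X in _ + X]big_nat_cond [X in _ + X]big1 ?addr0.
  by rewrite big_mkord.
by move=> j /andP[/andP[mj _] _]; rewrite out ?mj ?orbT.
Qed.

(** The bound on the corners does not depend on [n], so the maps agree on the increasing corners and
    extend together to their closure, which is [K]. *)
Lemma corner_tensor_extend x : exists F : K -> C, [/\ linear F,
  forall k, nrm (F k) <= 2 * nrm x * nrm k
  & forall n k, corner p n k -> F k = corner_tensor n x k].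
Proof.
have [||c k y k' y'|k|F [lF bF FE]] := @extend_bounded R K C
  (fun k y => exists n, corner p n k /\ y = corner_tensor n x k) (2 * nrm x).
- by rewrite mulr_ge0 ?nrm_ge0.
- by move=> k y [n [nk ->]]; exact: ct_bound.
- move=> [n [nk ->]] [n' [nk' ->]]; exists (maxn n n').
  have {}nk1 := corner_le pu (leq_maxl n n') nk.
  have {}nk1' := corner_le pu (leq_maxr n n') nk'.
  split; first exact: corner_linear.
  rewrite -(ct_widen x (leq_maxl n n') nk) -(ct_widen x (leq_maxr n n') nk').
  by rewrite ctDr ctZr.
- apply: near_set_trans (corner_near pu k) _ => k' [n nk'].
  by apply: near_set_refl; exists (corner_tensor n x k'), n.
exists F; split=> // n k nk; apply: FE; by exists n.
Qed.

Variable tau : C -> K -> C.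
Hypothesis tauP : forall x, [/\ linear (tau x),
  forall k, nrm (tau x k) <= 2 * nrm x * nrm k
  & forall n k, corner p n k -> tau x k = corner_tensor n x k].

Let tauE x n k : corner p n k -> tau x k = corner_tensor n x k.
Proof. by have [_ _] := tauP x; exact. Qed.

Let tau_lip x : lip (tau x).
Proof.
have [lt bt _] := tauP x; apply: lip_linear bt => //.
by rewrite mulr_ge0 ?nrm_ge0.
Qed.

Let finite_rank := [set k | exists n, corner p n k].

Let tau_linearl k : linear (tau^~ k).
Proof.
move=> c x y; apply: (@lip_near_eq _ _ _ (tau (c *: x + y))
  (fun k => c *: tau x k + tau y k) finite_rank) (corner_near pu k).
- exact: tau_lip.
- by apply: lipD; [apply: lipZ|]; exact: tau_lip.
- by move=> h [n nh]; rewrite !(tauE _ nh) ctDl ctZl.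
Qed.

HB.instance Definition _ := bilinear_isBilinear.Build R[i] C K C *:%R *:%R tau
  (tau_linearl, fun x => let: And3 lt _ _ := tauP x in lt).

Let tau_mul x x' k k' : tau (x ** x') (k ** k') = tau x k ** tau x' k'.
Proof.
apply: (@lip_near_eq _ _ _ (fun k => tau (x ** x') (k ** k'))
  (fun k => tau x k ** tau x' k') finite_rank) (corner_near pu k).
- by apply: (lip_comp (tau_lip _)); apply: lip_cmulr; exact: lip_id.
- by apply: lip_cmulr; exact: tau_lip.
- move=> h [n nh]; apply: (@lip_near_eq _ _ _ (fun k' => tau (x ** x') (h ** k'))
    (fun k' => tau x h ** tau x' k') finite_rank) (corner_near pu k').
  + by apply: (lip_comp (tau_lip _)); apply: lip_cmull; exact: lip_id.
  + by apply: lip_cmull; exact: tau_lip.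
  + move=> h' [n' nh'].
    have mh := corner_le pu (leq_maxl n n') nh.
    have mh' := corner_le pu (leq_maxr n n') nh'.
    by rewrite (tauE _ (cornerM mh mh')) (tauE _ mh) (tauE _ mh') ctM.
Qed.

Let tau_star x k : tau x^# k^# = (tau x k)^#.
Proof.
apply: (@lip_near_eq _ _ _ (fun k => tau x^# k^#)
  (fun k => (tau x k)^#) finite_rank) (corner_near pu k).
- by apply: (lip_comp (tau_lip _)); apply: lip_cstar; exact: lip_id.
- by apply: lip_cstar; exact: tau_lip.
- by move=> h [n nh]; rewrite (tauE _ nh) (tauE _ (corner_star pu nh)) ct_star.
Qed.

Let tau_mx_unit x i j : tau x (p i j) = M i j x.
Proof.
have mi : (i < (maxn i j).+1)%N by rewrite ltnS leq_maxl.
have mj : (j < (maxn i j).+1)%N by rewrite ltnS leq_maxr.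
rewrite (tauE _ (corner_mx_unit_ij pu mi mj)) /corner_tensor.
rewrite (bigD1 (Ordinal mi))//= (bigD1 (Ordinal mj))//=.
rewrite (entry_mx_unit pu) !eqxx scale1r !big1 ?addr0// => [k|k kj].
  move=> ki; rewrite big1// => l _; rewrite (entry_mx_unit pu) ifN ?scale0r//.
  by rewrite negb_and; apply/orP; left; apply: contra ki => /eqP ki; apply/eqP/val_inj.
rewrite (entry_mx_unit pu) ifN ?scale0r// eqxx /=.
by apply: contra kj => /eqP kj; apply/eqP/val_inj.
Qed.

(* Removing an element [a (x) k] with [k] nonzero: some entry of [k] is
   nonzero, and the vanishing of the corresponding coefficient expresses [a]
   through the other factors. *)
Let coefficients_tensor_eq0 (s : seq (C * K)) :
  (forall i j, \sum_(e <- s) entry p e.2 i j *: e.1 = 0) -> tensor_eq0 s.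
Proof.
move=> s0 V phi.
have [n] := ubnP (size s); elim: n => // n IH in s s0 *.
case: s s0 => [|[a k] s] s0 /=; first by rewrite big_nil.
rewrite ltnS => sn; rewrite big_cons /=.
have [k0|] := pselect (forall i j, entry p k i j = 0).
  rewrite (entry_eq0 pu k0) linear0r add0r; apply: IH => // i j.
  by have := s0 i j; rewrite big_cons /= k0 scale0r add0r.
move=> /existsNP[i /existsNP[j /eqP kij]].
pose c (e : C * K) := entry p e.2 i j / entry p k i j.
have aE : a = - \sum_(e <- s) c e *: e.1.
  apply/eqP; rewrite -addr_eq0 -(inj_eq (scalerI kij)) scaler0; apply/eqP.
  rewrite -[RHS](s0 i j) big_cons /= scalerDr scaler_sumr; congr (_ + _).
  by apply: eq_bigr => e _; rewrite scalerA mulrCA divff// mulr1.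
have <- : \sum_(e <- [seq (e.1, e.2 - c e *: k) | e <- s]) phi e.1 e.2 =
    phi a k + \sum_(e <- s) phi e.1 e.2.
  rewrite big_map aE linearNl linear_sumlz /= -sumrN -big_split /=.
  by apply: eq_bigr => e _; rewrite linearBr linearZr_LR linearZl_LR addrC.
apply: IH; last by rewrite size_map.
move=> u v; rewrite big_map /=.
under eq_bigr => e _ do rewrite (linB (entry_linear pu u v)) entryZ scalerBl.
rewrite sumrB /= -[RHS](s0 u v) big_cons /= [RHS]addrC; congr (_ + _).
rewrite aE scalerN; congr (- _); rewrite scaler_sumr.
by apply: eq_bigr => e _; rewrite mulrC scalerA.
Qed.

(** Multiplying by [tau a (p 0 i)] on the left and [tau b (p j 0)] on the right isolates the
    coefficient [x] at [(i, j)], in the form [M 0 0 (a x b)]. As [M 0 0] is isometric, all [a x b]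
    vanish, hence [x]. *)
Let tau_injective (s : seq (C * K)) :
  \sum_(e <- s) tau e.1 e.2 = 0 -> tensor_eq0 s.
Proof.
move=> s0; apply: coefficients_tensor_eq0 => i j.
apply: cmul_sandwich_eq0 => a b.
set x := \sum_(e <- s) _; suff : M 0 0 (a ** x ** b) = 0.
  by move=> ax0; apply: nrm0_eq0; rewrite -(cs_nrm cs 0 0) ax0 nrm0.
have -> : M 0 0 (a ** x ** b) =
    tau a (p 0 i) ** (\sum_(e <- s) tau e.1 e.2) ** tau b (p j 0).
  rewrite /x !cmul_sumr !cmul_suml -tau_mx_unit.
  rewrite (lin_sum (tau_linearl (p 0 0))); apply: eq_bigr => e _.
  rewrite -!tau_mul cmulZr cmulZl (linZ (tau_linearl _)).
  have -> : p 0 i ** e.2 ** p j 0 = entry p e.2 i j *: p 0 0.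
    have -> : p 0 i ** e.2 ** p j 0 =
        p 0 i ** (p i i ** e.2 ** p j j) ** p j 0.
      rewrite !cmulA (mx_unitM pu) eqxx -[_ ** p j j ** _]cmulA.
      by rewrite (mx_unitM pu) eqxx.
    rewrite (entryE pu) cmulZr cmulZl !(mx_unitM pu) eqxx.
    by rewrite (mx_unitM pu) eqxx.
  by have [lt _ _] := tauP (a ** e.1 ** b); rewrite (linZ lt).
by rewrite s0 cmul0r cmul0l.
Qed.

Let tau_dense : dense [set t | exists s : seq (C * K),
  t = \sum_(e <- s) tau e.1 e.2].
Proof.
apply/dense_nrm => x; apply: near_set_trans (cs_dense cs x) _ => _ [r ->].
apply: near_set_refl; exists [seq (e.1, p e.2.1 e.2.2) | e <- r].
by rewrite big_map; apply: eq_bigr => e _; rewrite /= tau_mx_unit.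
Qed.

Lemma compression_tensor : exists f : {bilinear C -> K -> C}, is_Cstar_tensor f.
Proof.
exists tau; split.
- by move=> *; exact: tau_mul.
- exact: tau_star.
- exact: tau_injective.
- exact: tau_dense.
Qed.

End TensorProduct.

Lemma matricial_stable (R : realType) (C K : cstarAlgType R)
  (rho : K -> ell2 R -> ell2 R) (p : nat -> nat -> K) :
  is_compact_operators rho -> matrix_units p -> matricial [set: C] -> stable C.
Proof.
move=> Krho pu /matricial_compression[M cs].
exists K, rho; split=> //.
have [tau tauP] := choice (corner_tensor_extend pu cs).
have [f ft] := compression_tensor pu cs tauP.
by exists C, f; split=> //; exists id; split; [split | exists id].
Qed.

(** * Matrix units of the compact operators *)

Section Ell2.
Variable R : realType.
Implicit Types x y z : ell2 R.

Definition partial_sqr x n : R := \sum_(0 <= i < n) normc (x i) ^+ 2.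

Lemma ell2_cvg x : cvgn (series (fun n => normc (x n) ^+ 2)).
Proof. by have /asboolP := ell2valP x. Qed.

Lemma ell2D x y n : (x + y) n = x n + y n. Proof. by []. Qed.

Lemma ell2B x y n : (x - y) n = x n - y n. Proof. by []. Qed.

Lemma ell2Z (c : R[i]) x n : (c *: x) n = c * x n. Proof. by []. Qed.

Lemma ell2_norm_sqr x :
  ell2_norm x ^+ 2 = limn (series (fun n => normc (x n) ^+ 2)).
Proof.
rewrite /ell2_norm sqr_sqrtr//; apply: limr_ge; first exact: ell2_cvg.
by apply: nearW => k; apply: sumr_ge0 => i _; exact: sqr_ge0.
Qed.

Lemma partial_sqr_le_norm x n : partial_sqr x n <= ell2_norm x ^+ 2.
Proof.
rewrite ell2_norm_sqr; apply: (@nondecreasing_cvgn_le _ _ _ (@ell2_cvg x) n).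
by apply/nondecreasing_seqP => k; rewrite seriesSr lerDl sqr_ge0.
Qed.

Lemma ell2_norm_ge0 x : 0 <= ell2_norm x.
Proof. exact: sqrtr_ge0. Qed.

Lemma ell2_norm_le x (c : R) : 0 <= c -> (forall n, partial_sqr x n <= c ^+ 2) ->
  ell2_norm x <= c.
Proof.
move=> c0 xc; rewrite -[leRHS]ger0_norm// -sqrtr_sqr ler_wsqrtr//.
by apply: limr_le; [exact: ell2_cvg | exact: nearW].
Qed.

Lemma partial_sqr_tail x (e : R) : 0 < e -> exists N, forall n, (N <= n)%N ->
  ell2_norm x ^+ 2 - partial_sqr x n < e.
Proof.
move=> e0; have /cvgrPdist_lt/(_ e e0)[N _ Nx] := @ell2_cvg x.
exists N => n /Nx; apply: le_lt_trans.
by rewrite ell2_norm_sqr ler_norm.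
Qed.

Lemma normc_coord_le x n : normc (x n) <= ell2_norm x.
Proof.
rewrite -(@ler_pXn2r _ 2) ?nnegrE ?ell2_norm_ge0 ?sqrtr_ge0//; last first.
  exact: normc_nneg.
apply: le_trans (partial_sqr_le_norm x n.+1).
by rewrite /partial_sqr big_nat_recr//= lerDr sumr_ge0// => i _; exact: sqr_ge0.
Qed.

Lemma single_square_summable (c : R[i]) j :
  (fun n => if n == j then c else 0) \in @square_summable R.
Proof.
apply/asboolP/cvg_ex; exists (normc c ^+ 2); apply: cvg_near_cst.
exists j.+1 => // n /= jn; rewrite /series /= (bigD1_seq j) ?iota_uniq//=.
  rewrite eqxx big1 ?addr0// => i ij.
  by rewrite (negPf ij) normc0 expr0n.
by rewrite mem_index_iota.
Qed.

Definition single c j : ell2 R := Ell2 (single_square_summable c j).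

Lemma ell2P x y : (forall n, x n = y n) -> x = y.
Proof. by move=> xy; apply: val_inj; apply/funext. Qed.

Lemma limn_single (f : nat -> R[i]) j : (forall n, n != j -> f n = 0) ->
  limn (series (f : nat -> R[i]^o)) = f j.
Proof.
move=> fj; apply: lim_near_cst; first exact: norm_hausdorff.
exists j.+1 => // n /= jn; rewrite /series /= (bigD1_seq j) ?iota_uniq//=.
  by rewrite big1 ?addr0// => i ij; rewrite fj.
by rewrite mem_index_iota.
Qed.

Lemma ell2_inner_singler x c j : ell2_inner x (single c j) = x j * c^*.
Proof.
rewrite /ell2_inner (@limn_single _ j) ?eqxx//= ?eqxx// => n nj.
by rewrite (negPf nj) rmorph0 mulr0.
Qed.

Lemma ell2_inner_singlel x c j : ell2_inner (single c j) x = c * (x j)^*.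
Proof.
rewrite /ell2_inner (@limn_single _ j) ?eqxx//= ?eqxx// => n nj.
by rewrite (negPf nj) mul0r.
Qed.

Lemma ell2_norm_single c j : ell2_norm (single c j) = normc c.
Proof.
apply/eqP; rewrite eq_le; have := normc_coord_le (single c j) j.
rewrite /= eqxx => ->; rewrite andbT; apply: ell2_norm_le => [|n].
  exact: normc_nneg.
rewrite /partial_sqr; have [jn|nj] := ltnP j n; last first.
  rewrite big_nat_cond big1 ?sqr_ge0// => i; rewrite andbT => /andP[_ ij].
  by rewrite /= ifN ?normc0 ?expr0n// ltn_eqF// (leq_trans ij).
rewrite (bigD1_seq j) ?iota_uniq ?mem_index_iota//= eqxx big1 ?addr0// => i ij.
by rewrite (negPf ij) normc0 expr0n.
Qed.

Lemma singleZ c d j : single (c * d) j = c *: single d j.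
Proof. by apply: ell2P => n; rewrite ell2Z /=; case: ifP => _; rewrite ?mulr0. Qed.

Lemma ell2_inner_self_ge0 x : 0 <= ell2_inner x x.
Proof.
have xx : tends (series (fun n => x n * (x n)^* : R[i]^o)) (ell2_norm x ^+ 2)%:C.
  move=> e /(partial_sqr_tail x)[N Nx]; exists N => n /Nx.
  have -> : series (fun n => x n * (x n)^* : R[i]^o) n = (partial_sqr x n)%:C.
    rewrite /partial_sqr rmorph_sum; apply: eq_bigr => i _.
    by rewrite rmorphXn; exact/esym/sqr_normc.
  rewrite nrmBC -rmorphB /nrm normc_def /= expr0n addr0 sqrtr_sqr.
  by rewrite ger0_norm// subr_ge0 partial_sqr_le_norm.
suff -> : ell2_inner x x = (ell2_norm x ^+ 2)%:C by rewrite ler0c sqr_ge0.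
apply: (@cvg_lim _ (@norm_hausdorff _ R[i]^o)) => A /nbhs_nrm[e e0 eA]; have [N Nx] := xx e e0.
by exists N => // n /Nx; rewrite nrmBC; exact: eA.
Qed.

Definition elem_op i j x : ell2 R := single (x j) i.

Lemma elem_op_linear i j : linear (elem_op i j).
Proof.
move=> c x y; apply: ell2P => n; rewrite ell2D ell2Z /=.
by case: ifP => _; rewrite ?mulr0 ?addr0.
Qed.

(** Bolzano-Weierstrass for the real parts, then for the imaginary parts along the subsequence
    found. *)
Lemma bounded_complex_subsequence (u : nat -> R[i]) (M : R) :
  (forall n, normc (u n) <= M) ->
  exists (k : nat -> nat) (l : R[i]), {homo k : m n / (m < n)%N} /\
    (fun n => normc (u (k n) - l)) @ \oo --> (0 : R).
Proof.
move=> uM.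
have ReM (z : R[i]) : `|complex.Re z| <= normc z :> R.
  by rewrite -lecR; exact: normc_ge_Re.
have ImM (z : R[i]) : `|complex.Im z| <= normc z :> R.
  case: z => a b; rewrite /normc /= -sqrtr_sqr ler_wsqrtr// lerDr.
  exact: sqr_ge0.
have bnd (v : nat -> R) : (forall n, `|v n| <= M) -> bounded_fun v.
  move=> vM; exists M; split; first exact: num_real.
  by move=> x Mx n _; apply: le_trans (vM n) (ltW Mx).
have [k1 k1m /cvg_ex[a ua]] := bolzano_weierstrass
  (bnd (fun n => complex.Re (u n)) (fun n => le_trans (ReM _) (uM n))).
have [k2 k2m /cvg_ex[b ub]] := bolzano_weierstrass
  (bnd (fun n => complex.Im (u (k1 n))) (fun n => le_trans (ImM _) (uM _))).
exists (k1 \o k2), (a +i* b); split.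
  by move=> m n mn; rewrite /= (leqW_mono k1m) (leqW_mono k2m).
have ub' (z : R[i]) : normc z <= `|complex.Re z| + `|complex.Im z|.
  case: z => c d /=; rewrite -[leRHS]ger0_norm ?addr_ge0// -sqrtr_sqr ler_wsqrtr//.
  rewrite sqrrD !real_normK ?num_real// addrAC lerDl.
  by rewrite mulrn_wge0// mulr_ge0.
have nonneg := @normc_nneg R.
have k2n n : (n <= k2 n)%N.
  elim: n => // n IH; apply: (leq_ltn_trans IH).
  by rewrite (leqW_mono k2m).
apply/cvgrPdist_lt => e e0; have e2 : 0 < e / 2 by rewrite divr_gt0.
move/cvgrPdist_lt: ua => /(_ _ e2)[N1 _ h1].
move/cvgrPdist_lt: ub => /(_ _ e2)[N2 _ h2].
exists (maxn N1 N2) => // n; rewrite /= geq_max => /andP[n1 n2].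
rewrite sub0r normrN ger0_norm//; apply: le_lt_trans (ub' _) _.
have ReB (z w : R[i]) : complex.Re (z - w) = complex.Re z - complex.Re w.
  by case: z w => ? ? [? ?].
have ImB (z w : R[i]) : complex.Im (z - w) = complex.Im z - complex.Im w.
  by case: z w => ? ? [? ?].
rewrite ReB ImB [e]splitr; apply: ltrD; rewrite distrC; last exact: h2.
exact: h1 (leq_trans n1 (k2n n)).
Qed.

Lemma elem_op_compact i j : compact_operator (elem_op i j).
Proof.
split; first exact: elem_op_linear.
move=> u [M uM].
have [|k [l [km kl]]] := @bounded_complex_subsequence (fun n => u n j) M.
  by move=> n; apply: le_trans (normc_coord_le _ _) (uM n).
exists k, (single l i); split=> //.
rewrite (_ : (fun n => _) = (fun n => normc (u (k n) j - l)))//.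
apply/funext => n; rewrite -(ell2_norm_single _ i); congr ell2_norm.
by apply: ell2P => m; rewrite ell2B /=; case: ifP => _; rewrite ?subr0.
Qed.

End Ell2.

Section CompactOperators.
Variables (R : realType) (K : cstarAlgType R) (rho : K -> ell2 R -> ell2 R).
Hypothesis Krho : is_compact_operators rho.

Let rho_linear : linear rho. Proof. by case: Krho => -[]. Qed.

Let rhoM a b x : rho (a ** b) x = rho a (rho b x).
Proof. by case: Krho => -[_ -> _]. Qed.

Let rho_adj a x y : ell2_inner (rho a x) y = ell2_inner x (rho a^# y).
Proof. by case: Krho => -[]. Qed.

Let rho_nrm a : nrm a = opnorm (rho a).
Proof. by apply: complexI; rewrite -nrmE; case: Krho => _ ->. Qed.

Let rho_compact a : compact_operator (rho a).
Proof. by case: Krho => _ _ <-; exists a. Qed.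

Let rhoZ c a x : rho (c *: a) x = c *: rho a x.
Proof. by rewrite (linZ rho_linear). Qed.

Let rhoB a b x : rho (a - b) x = rho a x - rho b x.
Proof. by rewrite (linB rho_linear). Qed.

Let rho_lin a : linear (rho a). Proof. by have [] := rho_compact a. Qed.

Let rho_inj a b : (forall x, rho a x = rho b x) -> a = b.
Proof.
move=> ab; apply/subr0_eq/nrm0_eq0; rewrite rho_nrm /opnorm.
rewrite (_ : [set _ | _ in _] = [set 0]) ?sup1//.
have z x : ell2_norm (rho (a - b) x) = 0.
  rewrite rhoB ab subrr; apply/eqP; rewrite eq_le ell2_norm_ge0 andbT.
  apply: ell2_norm_le => // n; rewrite expr0n /partial_sqr big1// => i _.
  by rewrite normc0 expr0n.
apply/seteqP; split=> [_ [x _ <-]|_ ->]; first by rewrite /= z.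
exists 0; last exact: z.
rewrite /= (_ : 0 = single 0 0); last by apply: ell2P => n /=; rewrite if_same.
by rewrite ell2_norm_single normc0.
Qed.

Let unit_ex (ij : nat * nat) : exists a, rho a = elem_op ij.1 ij.2.
Proof.
have : range rho (elem_op ij.1 ij.2).
  by case: Krho => _ _ ->; exact: elem_op_compact.
by case=> a _ ?; exists a.
Qed.

Lemma compact_operators_matrix_units : exists p : nat -> nat -> K, matrix_units p.
Proof.
have [p0 p0E] := choice unit_ex; pose p (i j : nat) := p0 (i, j).
have pE i j x : rho (p i j) x = single (x j) i by rewrite p0E.
have pM i j k l : p i j ** p k l = if j == k then p i l else 0.
  apply: rho_inj => x; rewrite rhoM !pE; case: eqVneq => [<-|jk].
    by rewrite pE /= eqxx.
  rewrite /= (negPf jk) (lin0 rho_linear).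
  by apply: ell2P => n /=; rewrite if_same.
have ps i j : (p i j)^# = p j i.
  apply: rho_inj => y; apply: ell2P => n.
  have := rho_adj (p i j) (single 1 n) y.
  rewrite ell2_inner_singlel mul1r !pE ell2_inner_singlel /= => h.
  apply: (can_inj (@conjCK _)); rewrite -h eq_sym.
  by case: ifP => _; rewrite ?mul1r// mul0r rmorph0.
have p00 : nrm (p 0 0) = 1.
  have : nrm (p 0 0) * nrm (p 0 0) = nrm (p 0 0) * 1.
    by rewrite -expr2 -nrm_star ps pM eqxx mulr1.
  apply: mulfI; apply/eqP => /nrm0_eq0 p_eq0.
  have := pE 0 0 (single 1 0); rewrite p_eq0 (lin0 rho_linear).
  move=> /(congr1 (fun x : ell2 R => x 0)) /= /eqP.
  by rewrite eq_sym oner_eq0.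
have scalE a i j : p i i ** a ** p j j = (rho a (single 1 j) i) *: p i j.
  apply: rho_inj => x; rewrite !rhoM rhoZ !pE -singleZ.
  have -> : single (x j) j = x j *: single 1 j by rewrite -singleZ mulr1.
  by rewrite (linZ (rho_lin a)) ell2Z mulrC.
(* The coefficient is the inner product of [a e_0] with itself, hence nonnegative; the C*-identity
   then identifies it. *)
have pos a : p 0 0 ** a^# ** a ** p 0 0 = (nrm (a ** p 0 0) ^+ 2)%:C *: p 0 0.
  pose z := rho a (single 1 0).
  have aE : p 0 0 ** a^# ** a ** p 0 0 = ell2_inner z z *: p 0 0.
    rewrite -[p 0 0 ** a^# ** a]cmulA scalE; congr (_ *: _).
    have := rho_adj a^# z (single 1 0).
    by rewrite cstarK ell2_inner_singler rmorph1 mulr1 -rhoM.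
  have := congr1 (@nrm _ _) aE.
  have -> : p 0 0 ** a^# ** a ** p 0 0 = (a ** p 0 0)^# ** (a ** p 0 0).
    by rewrite cstarM ps !cmulA.
  rewrite nrm_star nrmZ p00 mulr1 => ->.
  have -> : (normc (ell2_inner z z))%:C = ell2_inner z z.
    exact: ger0_norm (ell2_inner_self_ge0 z).
  by rewrite cstarM ps !cmulA aE.
have qE n x m : rho (corner_unit p n) x m = if (m < n)%N then x m else 0.
  have -> : rho (corner_unit p n) x m = \sum_(i < n) rho (p i i) x m.
    rewrite (lin_sum rho_linear) fct_sumE.
    exact: (@big_morph _ _ (fun x : ell2 R => x m) 0 +%R 0 +%R).
  under eq_bigr => i _ do rewrite pE /=.
  case: ltnP => [mn|nm].
    rewrite (bigD1 (Ordinal mn))//= eqxx big1 ?addr0// => i im.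
    by rewrite ifN//; apply: contra im => /eqP mi; apply/eqP/val_inj.
  by rewrite big1// => i _; rewrite ifN// gtn_eqF// (leq_trans (ltn_ord i)).
(* Compactness enters here. Otherwise [|(1 - q_n) a x| > e / 2] for arbitrarily large [n] and
   vectors [x] of the unit ball; along a subsequence [a x] tends to some [y], while
   [|(1 - q_n) a x|^2] is at most [2 |a x - y|^2 + 2 |(1 - q_n) y|^2]. Both squares are eventually
   below [(e / 8)^2], and [4 (e / 8)^2 < (e / 2)^2]. *)
have near a (e : R) : 0 < e -> exists N, forall n, (N <= n)%N ->
    nrm (a - corner_unit p n ** a) < e.
  move=> e0; apply: contrapT => /forallNP far.
  have bad N : exists nx : nat * ell2 R, [/\ (N <= nx.1)%N, ell2_norm nx.2 <= 1
      & e / 2 < ell2_norm (rho (a - corner_unit p nx.1 ** a) nx.2)].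
    have /existsNP[n /not_implyP[Nn /negP]] := far N; rewrite -leNgt rho_nrm => en.
    have [||_ [x x1 <-] ex] := @sup_gt _ [set ell2_norm (rho
      (a - corner_unit p n ** a) x) | x in [set x | ell2_norm x <= 1]] (e / 2).
    - exists (ell2_norm (rho (a - corner_unit p n ** a) (single 1 0))).
      by exists (single 1 0) => //=; rewrite ell2_norm_single normc1.
    - by apply: lt_le_trans en; lra.
    - by exists (n, x).
  have [u uP] := choice bad.
  have [|k [y [km ky]]] := (rho_compact a).2 (fun n => (u n).2).
    by exists 1 => n; have [] := uP n.
  have d0 : 0 < e / 8 by rewrite divr_gt0.
  have [N Ny] := partial_sqr_tail y (exprn_gt0 2 d0).
  move/cvgrPdist_lt: ky => /(_ _ d0)[N' _ ky].
  have kn n : (n <= k n)%N by elim: n => // n IH; exact: leq_ltn_trans IH (km _ _ _).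
  set j := maxn N N'; have [le_kn _] := uP (k j).
  set n := (u (k j)).1; set x := (u (k j)).2; apply/negP; rewrite -leNgt.
  have Nn : (N <= n)%N.
    by apply: leq_trans le_kn; apply: leq_trans (kn j); exact: leq_maxl.
  have wy : ell2_norm (rho a x - y) < e / 8.
    have := ky j (leq_maxr _ _); rewrite /= sub0r normrN ger0_norm//.
    exact: ell2_norm_ge0.
  rewrite rhoB rhoM; set w := rho a x in wy *.
  apply: ell2_norm_le => [|m]; first by rewrite divr_ge0// ltW.
  apply: (@le_trans _ _ (2 * partial_sqr (w - y) m
      + 2 * \sum_(0 <= i < m) (if (i < n)%N then 0 else normc (y i) ^+ 2))).
    rewrite /partial_sqr !mulr_sumr -big_split; apply: ler_sum => i _.
    rewrite -[leRHS]/(2 * normc (w i - y i) ^+ 2 +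
      2 * (if (i < n)%N then 0 else normc (y i) ^+ 2)).
    rewrite [X in normc X ^+ 2 <= _]ell2B qE; case: ifP => _.
      by rewrite subrr normc0 expr0n mulr0 addr0 mulr_ge0// sqr_ge0.
    rewrite subr0 -{1}[w i](subrK (y i)).
    have := le_normcD (w i - y i) (y i).
    have nonneg := @normc_nneg R.
    have := nonneg (w i - y i); have := nonneg (y i); have := nonneg (w i - y i + y i).
    move: (normc _) (normc (w i - y i)) (normc (y i)) => s t v s0 v0 t0 stv.
    have := sqr_ge0 (t - v); rewrite !expr2; nra.
  have tail : \sum_(0 <= i < m) (if (i < n)%N then 0 else normc (y i) ^+ 2) <=
      ell2_norm y ^+ 2 - partial_sqr y n.
    rewrite lerBrDr; apply: le_trans (partial_sqr_le_norm y (maxn n m)).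
    rewrite /partial_sqr [leRHS](big_cat_nat (leq0n n) (leq_maxl n m)) /= [leLHS]addrC lerD2l.
    have [nm|mn] := leqP n m.
      rewrite (big_cat_nat (leq0n n) nm) /= big_nat_cond big1 ?add0r.
        by rewrite ler_sum_nat// => i /andP[ni _]; rewrite ltnNge ni.
      by move=> i /andP[/andP[_ ->]].
    rewrite big_nat_cond big1 ?sumr_ge0// => [i _|i /andP[/andP[_ im] _]].
      exact: sqr_ge0.
    by rewrite (ltn_trans im).
  have := Ny n Nn; have := partial_sqr_le_norm (w - y) m.
  have : ell2_norm (w - y) ^+ 2 <= (e / 8) ^+ 2.
    by rewrite ler_sqr ?nnegrE ?ell2_norm_ge0 ?ltW.
  rewrite !exprMn; have : 0 < e ^+ 2 by exact: exprn_gt0.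
  by rewrite !exprVn; move: (e ^+ 2) tail => e2; lra.
exists p; split=> //.
- by move=> a i j; exists (rho a (single 1 j) i).
- move=> a e e0; have e2 : 0 < e / 2 by rewrite divr_gt0.
  (* Two-sided approximation from one-sided ones: [a - q a q = (a - q a) + q (a - a q)], and
     [a - a q] is the adjoint of [a^# - q a^#]. *)
  have [N Na] := near a _ e2; have [N' Na'] := near a^# _ e2.
  exists (maxn N N'); set q := corner_unit p _.
  have qs : q^# = q by rewrite cstar_sum; apply: eq_bigr => i _; exact: ps.
  have qq : q ** q = q.
    rewrite {1}/q /corner_unit cmul_suml; apply: eq_bigr => i _.
    rewrite cmul_sumr (bigD1 i)//= pM eqxx big1 ?addr0// => j ji.
    by rewrite pM ifN// eq_sym.
  have q1 : nrm q <= 1.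
    have : nrm q * nrm q = nrm q by rewrite -expr2 -nrm_star qs qq.
    by have := nrm_ge0 q; nra.
  apply: le_lt_trans (nrm_tri (q ** a) _ _) _; rewrite [e]splitr.
  apply: ltr_leD; first exact: Na (leq_maxl _ _).
  rewrite -cmulA -cmulBr; apply: le_trans (nrmM _ _) _.
  have := Na' (maxn N N') (leq_maxr _ _); rewrite -[nrm (a^# - _)]nrm_cstar cstarB.
  rewrite cstarM cstarK -/q qs.
  by have := nrm_ge0 q; have := nrm_ge0 (a - a ** q); nra.
Qed.

End CompactOperators.

(** * Subalgebras and algebras of bounded functions *)

Record star_subalgebra (R : realType) (A : cstarAlgType R) (S : set A) : Prop :=
  StarSubalgebra {
    sub_linear : forall (c : R[i]) x y, S x -> S y -> S (c *: x + y);
    sub0 : S 0;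
    subM : forall x y, S x -> S y -> S (x ** y);
    sub_star : forall x, S x -> S x^#
}.

Section ClosedSubalgebra.
Variables (R : realType) (A : cstarAlgType R) (S : set A).
Hypotheses (hS : star_subalgebra S) (cS : near_set S `<=` S).

(** The proofs are arguments so that the structures inferred for the predicate, and for [sub_alg],
    can depend on them. *)
Definition sub_pred of star_subalgebra S & near_set S `<=` S : {pred A} :=
  fun x => `[< S x >].

Lemma sub_submod_closed : submod_closed (sub_pred hS cS).
Proof.
split; first by apply/asboolP; exact: sub0.
by move=> c x y /asboolP Sx /asboolP Sy; apply/asboolP; exact: sub_linear.
Qed.

End ClosedSubalgebra.

HB.instance Definition _ (R : realType) (A : cstarAlgType R) (S : set A)
    (hS : star_subalgebra S) (cS : near_set S `<=` S) :=
  GRing.isSubmodClosed.Build R[i] A (sub_pred hS cS) (sub_submod_closed hS cS).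

Record sub_alg (R : realType) (A : cstarAlgType R) (S : set A)
    (hS : star_subalgebra S) (cS : near_set S `<=` S) := SubAlg {
  sub_val :> A;
  sub_valP : sub_val \in sub_pred hS cS }.

HB.instance Definition _ R A S hS cS := [isSub for @sub_val R A S hS cS].
HB.instance Definition _ R A S hS cS := [Choice of @sub_alg R A S hS cS by <:].
HB.instance Definition _ R A S hS cS :=
  [SubChoice_isSubLmodule of @sub_alg R A S hS cS by <:].

Section SubalgebraStructure.
Variables (R : realType) (A : cstarAlgType R) (S : set A).
Hypotheses (hS : star_subalgebra S) (cS : near_set S `<=` S).

Local Notation B := (sub_alg hS cS).
Implicit Types x y : B.

Lemma sub_inS x : S (sub_val x).
Proof. by have /asboolP := sub_valP x. Qed.

Definition sub_in z (Sz : S z) : B := SubAlg (asboolT Sz : z \in sub_pred hS cS).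

Let smul x y : B := sub_in (subM hS (sub_inS x) (sub_inS y)).
Let sstar x : B := sub_in (sub_star hS (sub_inS x)).

Let sval_inj x y : sub_val x = sub_val y -> x = y.
Proof. exact: val_inj. Qed.

Let snormD x y : nrm (sub_val (x + y)) <= nrm (sub_val x) + nrm (sub_val y).
Proof. exact: nrmD. Qed.

Let snormZ (c : R[i]) x : nrm (sub_val (c *: x)) = normc c * nrm (sub_val x).
Proof. exact: nrmZ. Qed.

Let snorm_eq0 x : nrm (sub_val x) = 0 -> x = 0.
Proof. by move=> /nrm0_eq0 x0; apply: sval_inj. Qed.

Let scomplete (u : nat -> B) :
  (forall e : R, 0 < e -> exists N, forall m n, (N <= m)%N -> (N <= n)%N ->
    nrm (sub_val (u m - u n)) < e) ->
  exists x, forall e : R, 0 < e -> exists N, forall n, (N <= n)%N ->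
    nrm (sub_val (u n - x)) < e.
Proof.
move=> cu; have [|x ux] := @complete_nrm R A (fun n => sub_val (u n)); first exact: cu.
have Sx : S x by apply: cS; apply: tends_near ux _ => n; exact: sub_inS.
by exists (sub_in Sx).
Qed.

HB.instance Definition _ := @Lmodule_isCstarAlg.Build R B
  (fun x => nrm (sub_val x)) snormD snormZ snorm_eq0 scomplete smul sstar
  (fun x y z => sval_inj (cmulA _ _ _ :
    sub_val (smul x (smul y z)) = sub_val (smul (smul x y) z)))
  (fun x y z => sval_inj (cmulDl _ _ _ :
    sub_val (smul (x + y) z) = sub_val (smul x z + smul y z)))
  (fun x y z => sval_inj (cmulDr _ _ _ :
    sub_val (smul x (y + z)) = sub_val (smul x y + smul x z)))
  (fun c x y => sval_inj (cmulZl _ _ _ :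
    sub_val (smul (c *: x) y) = sub_val (c *: smul x y)))
  (fun c x y => sval_inj (cmulZr _ _ _ :
    sub_val (smul x (c *: y)) = sub_val (c *: smul x y)))
  (fun x y => sval_inj (cstarD _ _ :
    sub_val (sstar (x + y)) = sub_val (sstar x + sstar y)))
  (fun c x => sval_inj (cstarZ _ _ :
    sub_val (sstar (c *: x)) = sub_val (c^* *: sstar x)))
  (fun x y => sval_inj (cstarM _ _ :
    sub_val (sstar (smul x y)) = sub_val (smul (sstar y) (sstar x))))
  (fun x => sval_inj (cstarK _ :
    sub_val (sstar (sstar x)) = sub_val x))
  (fun x y => nrmM (sub_val x) (sub_val y)) (fun x => nrm_star (sub_val x)).

Lemma sub_nrm x : nrm x = nrm (sub_val x).
Proof. by []. Qed.

Lemma sub_val_morphism : star_morphism (@sub_val R A S hS cS).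
Proof. by []. Qed.

End SubalgebraStructure.

(** * Bounded functions with values in a C*-algebra *)

Section BoundedFunctions.
Variables (R : realType) (K : cstarAlgType R) (X : Type).

Definition bounded_map : {pred X -> K} :=
  fun f => `[< exists M : R, forall x, nrm (f x) <= M >].

Lemma bounded_map_submod_closed : submod_closed bounded_map.
Proof.
split; first by apply/asboolP; exists 0 => x; rewrite nrm0.
move=> c f g /asboolP[M fM] /asboolP[N gN]; apply/asboolP.
exists (normc c * M + N) => x; apply: le_trans (nrmD _ _) (lerD _ (gN x)).
rewrite nrmZ ler_wpM2l//; exact: normc_nneg.
Qed.

HB.instance Definition _ :=
  GRing.isSubmodClosed.Build R[i] (X -> K) bounded_map bounded_map_submod_closed.

End BoundedFunctions.

Record linf (R : realType) (K : cstarAlgType R) (X : Type) := Linf {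
  linf_val :> X -> K;
  linf_valP : linf_val \in @bounded_map R K X }.

HB.instance Definition _ R K X := [isSub for @linf_val R K X].
HB.instance Definition _ R K X := [Choice of @linf R K X by <:].
HB.instance Definition _ R K X := [SubChoice_isSubLmodule of @linf R K X by <:].

Section BoundedFunctionAlgebra.
Variables (R : realType) (K : cstarAlgType R) (X : Type).

Local Notation L := (linf K X).
Implicit Types f g : L.

Definition linf_nrm f : R := sup [set nrm (f x) | x in setT].

Let linf_has_ub f : has_ubound [set nrm (f x) | x in setT].
Proof.
by have /asboolP[M fM] := linf_valP f; exists M => _ [x _ <-].
Qed.

Let linf_nrm_ge f x : nrm (f x) <= linf_nrm f.
Proof.
apply: sup_ubound; last by exists x.
exact: linf_has_ub.
Qed.

Let linf_nrm_le f (c : R) : 0 <= c -> (forall x, nrm (f x) <= c) -> linf_nrm f <= c.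
Proof.
move=> c0 fc; rewrite /linf_nrm.
have [[y Sy]|S0] := pselect ([set nrm (f x) | x in setT] !=set0).
  by apply: ge_sup; [exists y | move=> _ [x _ <-]].
by rewrite sup_out// => -[].
Qed.

Let linf_nrm_ge0 f : 0 <= linf_nrm f.
Proof.
have [x|noX] := pselect (exists x : X, True); last first.
  rewrite /linf_nrm (_ : [set _ | _ in _] = set0) ?sup0//.
  by apply/seteqP; split=> [y [x _ _]|y//]; apply: noX; exists x.
by case: x => x _; apply: le_trans (linf_nrm_ge f x); exact: nrm_ge0.
Qed.

Lemma linfP f g : (forall x, f x = g x) -> f = g.
Proof. by move=> fg; apply: val_inj; apply/funext. Qed.

Definition linf_of (h : X -> K) (M : R) (hM : forall x, nrm (h x) <= M) : L :=
  Linf (asboolT (ex_intro _ M hM) : h \in @bounded_map R K X).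

Let lmul_bound f g x : nrm (f x ** g x) <= linf_nrm f * linf_nrm g.
Proof. by apply: le_trans (nrmM _ _) (ler_pM _ _ _ _); rewrite ?nrm_ge0 ?linf_nrm_ge. Qed.

Let lmul f g : L := linf_of (lmul_bound f g).

Let lstar_bound f x : nrm (f x)^# <= linf_nrm f.
Proof. by rewrite nrm_cstar linf_nrm_ge. Qed.

Let lstar f : L := linf_of (lstar_bound f).

Let lnormD f g : linf_nrm (f + g) <= linf_nrm f + linf_nrm g.
Proof.
apply: linf_nrm_le => [|x]; first by rewrite addr_ge0 ?linf_nrm_ge0.
exact: le_trans (nrmD _ _) (lerD (linf_nrm_ge _ _) (linf_nrm_ge _ _)).
Qed.

Let lnormZle (c : R[i]) f : linf_nrm (c *: f) <= normc c * linf_nrm f.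
Proof.
have c0 := normc_nneg c.
apply: linf_nrm_le => [|x]; first by rewrite mulr_ge0 ?linf_nrm_ge0.
by rewrite nrmZ ler_wpM2l ?linf_nrm_ge.
Qed.

Let lnormZ (c : R[i]) f : linf_nrm (c *: f) = normc c * linf_nrm f.
Proof.
apply/eqP; rewrite eq_le lnormZle /=; have [->|c0] := eqVneq c 0.
  by rewrite normc0 mul0r linf_nrm_ge0.
have nc : 0 < normc c by rewrite -ltcR -[(normc c)%:C]/`|c| normr_gt0.
rewrite -ler_pdivlMl// -normcV.
by apply: le_trans (lnormZle c^-1 (c *: f)); rewrite scalerA mulVf// scale1r.
Qed.

Let lnorm_eq0 f : linf_nrm f = 0 -> f = 0.
Proof.
move=> f0; apply: linfP => x; apply: nrm0_eq0; apply/eqP.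
by rewrite eq_le nrm_ge0 andbT -f0.
Qed.

Let lcomplete (u : nat -> L) :
  (forall e : R, 0 < e -> exists N, forall m n, (N <= m)%N -> (N <= n)%N ->
    linf_nrm (u m - u n) < e) ->
  exists f, forall e : R, 0 < e -> exists N, forall n, (N <= n)%N ->
    linf_nrm (u n - f) < e.
Proof.
move=> cu.
have [h uh] : {h : X -> K & forall x, tends (fun n => u n x) (h x)}.
  apply: (@choice _ _ (fun x y => tends (fun n => u n x) y)) => x.
  apply: complete_nrm => e /cu[N Nu].
  by exists N => m n Nm Nn; exact: le_lt_trans (linf_nrm_ge (u m - u n) x) (Nu m n Nm Nn).
have unif (e : R) : 0 < e -> exists N, forall n x, (N <= n)%N -> nrm (u n x - h x) <= e.
  move=> /cu[N Nu]; exists N => n x Nn; apply/ler_addgt0Pr => d d0.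
  have [M Mx] := uh x d d0; apply: le_trans (nrm_tri (u (maxn N M) x) _ _) _.
  apply: lerD; last by apply/ltW/Mx; exact: leq_maxr.
  apply: le_trans (linf_nrm_ge (u n - u (maxn N M)) x) _.
  by apply/ltW/Nu; rewrite ?leq_maxl.
have [N Nu] := unif 1 ltr01.
have hM x : nrm (h x) <= linf_nrm (u N) + 1.
  have := Nu N x (leqnn N); have := linf_nrm_ge (u N) x.
  by have := nrmB_ge (h x) (u N x); rewrite nrmBC; lra.
exists (linf_of hM) => e e0; have [|M Mu] := unif (e / 2); first by rewrite divr_gt0.
exists M => n Mn; apply: (@le_lt_trans _ _ (e / 2)); last lra.
by apply: linf_nrm_le => [|x]; [rewrite divr_ge0// ltW | exact: Mu].
Qed.

Let lnormM f g : linf_nrm (lmul f g) <= linf_nrm f * linf_nrm g.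
Proof. by apply: linf_nrm_le => [|x]; [rewrite mulr_ge0 ?linf_nrm_ge0 | exact: lmul_bound]. Qed.

Let lnorm_star f : linf_nrm (lmul (lstar f) f) = linf_nrm f ^+ 2.
Proof.
apply/eqP; rewrite eq_le; apply/andP; split.
  apply: linf_nrm_le => [|x]; first exact: sqr_ge0.
  by rewrite /= nrm_star ler_sqr ?nnegrE ?nrm_ge0 ?linf_nrm_ge0// linf_nrm_ge.
rewrite -[leRHS]sqr_sqrtr ?linf_nrm_ge0// ler_sqr ?nnegrE ?sqrtr_ge0 ?linf_nrm_ge0//.
apply: linf_nrm_le => [|x]; first exact: sqrtr_ge0.
rewrite -[leLHS]ger0_norm ?nrm_ge0// -sqrtr_sqr ler_wsqrtr// -nrm_star.
exact: (linf_nrm_ge (lmul (lstar f) f)).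
Qed.

HB.instance Definition _ := @Lmodule_isCstarAlg.Build R L
  linf_nrm lnormD lnormZ lnorm_eq0 lcomplete lmul lstar
  (fun f g h => linfP (fun x => cmulA (f x) (g x) (h x) :
    lmul f (lmul g h) x = lmul (lmul f g) h x))
  (fun f g h => linfP (fun x => cmulDl (f x) (g x) (h x) :
    lmul (f + g) h x = (lmul f h + lmul g h) x))
  (fun f g h => linfP (fun x => cmulDr (f x) (g x) (h x) :
    lmul f (g + h) x = (lmul f g + lmul f h) x))
  (fun c f g => linfP (fun x => cmulZl c (f x) (g x) :
    lmul (c *: f) g x = (c *: lmul f g) x))
  (fun c f g => linfP (fun x => cmulZr c (f x) (g x) :
    lmul f (c *: g) x = (c *: lmul f g) x))
  (fun f g => linfP (fun x => cstarD (f x) (g x) :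
    lstar (f + g) x = (lstar f + lstar g) x))
  (fun c f => linfP (fun x => cstarZ c (f x) :
    lstar (c *: f) x = (c^* *: lstar f) x))
  (fun f g => linfP (fun x => cstarM (f x) (g x) :
    lstar (lmul f g) x = lmul (lstar g) (lstar f) x))
  (fun f => linfP (fun x => cstarK (f x) :
    lstar (lstar f) x = f x))
  lnormM lnorm_star.

Lemma linf_ge f x : nrm (f x) <= nrm f.
Proof. exact: linf_nrm_ge. Qed.

Lemma linf_le f (c : R) : 0 <= c -> (forall x, nrm (f x) <= c) -> nrm f <= c.
Proof. exact: linf_nrm_le. Qed.

Lemma linf_mulE f g x : (f ** g) x = f x ** g x. Proof. by []. Qed.

Lemma linf_starE f x : f^# x = (f x)^#. Proof. by []. Qed.

Lemma linf_addE f g x : (f + g) x = f x + g x. Proof. by []. Qed.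

Lemma linf_subE f g x : (f - g) x = f x - g x. Proof. by []. Qed.

Lemma linf_scaleE (c : R[i]) f x : (c *: f) x = c *: f x. Proof. by []. Qed.

Lemma linf_sumE (I : Type) (r : seq I) (F : I -> L) x :
  (\sum_(i <- r) F i) x = \sum_(i <- r) F i x.
Proof. exact: (@big_morph _ _ (fun f : L => f x) 0 +%R 0 +%R). Qed.

End BoundedFunctionAlgebra.

(** * Stability gives matrix systems *)

Section NearSets.
Variable R : realType.

Lemma near_set_lip (U V : normedModType R[i]) (f : U -> V) (S : set U) (S' : set V) x :
  lip f -> (forall y, S y -> S' (f y)) -> near_set S x -> near_set S' (f x).
Proof.
move=> [L L0 fL] SS Sx e e0.
have [|y Sy xy] := Sx (e / (L + 1)); first by rewrite divr_gt0//; lra.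
exists (f y); first exact: SS.
apply: le_lt_trans (fL _ _) _; move: xy; rewrite ltr_pdivlMr; last lra.
by have := nrm_ge0 (x - y); nra.
Qed.

Lemma near_setD (V : normedModType R[i]) (S S' T : set V) x y :
  (forall x y, S x -> S' y -> T (x + y)) -> near_set S x -> near_set S' y ->
  near_set T (x + y).
Proof.
move=> SST Sx Sy e e0.
have [x' Sx' xx] := Sx (e / 2) ltac:(by rewrite divr_gt0).
have [y' Sy' yy] := Sy (e / 2) ltac:(by rewrite divr_gt0).
exists (x' + y'); first exact: SST.
by rewrite opprD addrACA; apply: le_lt_trans (nrmD _ _) _; lra.
Qed.

Lemma near_near_set (V : normedModType R[i]) (S : set V) :
  near_set (near_set S) `<=` near_set S.
Proof. by move=> x Sx; exact: near_set_trans Sx _. Qed.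

Lemma near_star_subalgebra (A : cstarAlgType R) (S : set A) :
  star_subalgebra S -> star_subalgebra (near_set S).
Proof.
move=> hS; split.
- move=> c x y Sx Sy; apply: near_setD Sy; last first.
    apply: (near_set_lip (S' := S) (lipZ c (@lip_id _ _)) _ Sx) => z Sz /=.
    by rewrite -[_ *: _]addr0; apply: (sub_linear hS) => //; exact: (sub0 hS).
  by move=> u v Su Sv; rewrite -[u]scale1r; exact: (sub_linear hS).
- exact: near_set_refl (sub0 hS).
- move=> x y Sx Sy; apply: near_near_set.
  apply: (near_set_lip (S := S) (lip_cmulr y (@lip_id _ _)) _ Sx) => z Sz /=.
  apply: (near_set_lip (S := S) (lip_cmull z (@lip_id _ _)) _ Sy) => w Sw /=.
  exact: (subM hS).
- move=> x Sx; apply: (near_set_lip (S := S) (lip_cstar (@lip_id _ _)) _ Sx) => y /=.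
  exact: (sub_star hS).
Qed.

End NearSets.

Lemma star_morphism_lip (R : realType) (A B : cstarAlgType R) (f : A -> B) :
  star_morphism f -> lip f.
Proof.
move=> sf; have [lf _ _] := sf; apply: (@lip_linear _ _ _ _ 2) => // x.
exact: star_morphism_bound.
Qed.

(** Stated for the image of a morphism because a stable ideal is given by an algebra with an
    inclusion. The system consists of the transported [b (x) p_kl]. It is dense because [tau a] is
    automatically bounded, so that [k] in [a (x) k] may be replaced by a finite matrix. *)
Lemma stable_matricial (R : realType) (B C : cstarAlgType R) (f : B -> C) :
  stable B -> star_morphism f -> matricial (range f).
Proof.
move=> [K [rho [Krho [T [tau [[tauM taus _ taud] [g [gm [h gK hK]]]]]]]]] fm.
have [p pu] := compact_operators_matrix_units Krho.
have [lf fM fs] := fm; have [lg gM gs] := gm.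
have lh : linear h by move=> c x y; apply: (can_inj gK); rewrite lg !hK.
have hm : star_morphism h.
  split=> [//|x y|x]; apply: (can_inj gK); first by rewrite gM !hK.
  by rewrite gs !hK.
have [_ hM hs] := hm.
exists B, (fun b k l => f (h (tau b (p k l)))), *:%R, (@cmul _ B), (@cstar _ B).
split.
- by move=> b k l; exists (h (tau b (p k l))).
- by move=> c b k l; rewrite linearZl_LR (linZ lh) (linZ lf).
- move=> b k l b' k' l'; rewrite -fM -hM -tauM (mx_unitM pu).
  by case: ifP => // _; rewrite linear0r (lin0 lh) (lin0 lf).
- by move=> b k l; rewrite -fs -hs -taus (mx_unit_star pu).
- move=> _ [b _ <-]; rewrite -(gK b).
  pose D := [set t | exists r : seq (B * (nat * nat)),
    t = \sum_(e <- r) tau e.1 (p e.2.1 e.2.2)].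
  have D0 : D 0 by exists [::]; rewrite big_nil.
  have DD x y : D x -> D y -> D (x + y).
    by move=> [r ->] [r' ->]; exists (r ++ r'); rewrite big_cat.
  have tau_lip a : lip (tau a).
    apply: (@lip_linear _ _ _ _ (2 * nrm a)).
    - by move=> c x y; rewrite linearPr.
    - by rewrite mulr_ge0 ?nrm_ge0.
    move=> k; apply: (@bilinear_bound _ _ _ _ setT) => //.
    - by move=> *; exact: linearDl.
    - by move=> *; exact: linearDr.
    - by move=> *; exact: linearZl_LR.
    - by move=> *; exact: linearZr_LR.
  have Dt t : near_set D t.
    move/dense_nrm: taud => /(_ t) tt; apply: near_set_trans tt _ => _ [s ->].
    apply: near_set_sum => // -[a k] /=.
    apply: (near_set_lip (tau_lip a) _ (corner_near pu k)) => k' [n nk].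
    rewrite (cornerE pu nk) linear_sumr; apply: big_ind => // i _.
    rewrite linear_sumr; apply: big_ind => // j _.
    exists [:: (entry p k' i j *: a, (nat_of_ord i, nat_of_ord j))].
    by rewrite big_seq1 /= linearZr_LR linearZl_LR.
  apply: (near_set_lip (S := D) (lip_comp (star_morphism_lip fm) (star_morphism_lip hm))
    _ (Dt (g b))) => _ [r ->].
  exists r; rewrite /block_sum /= (lin_sum lh) (lin_sum lf).
  by [].
Qed.

Lemma matricial_sub (R : realType) (A : cstarAlgType R) (S : set A)
    (hS : star_subalgebra S) (cS : near_set S `<=` S) :
  matricial S -> matricial [set: sub_alg hS cS].
Proof.
move=> [B [m [scl [mul [str ms]]]]].
exists B, (fun b k l => sub_in hS cS (ms_in ms b k l)), scl, mul, str.
split=> //.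
- by move=> c b k l; apply: val_inj; exact: (msZ ms).
- move=> b k l b' k' l'; apply: val_inj; have := msM ms b k l b' k' l'.
  by case: ifP.
- by move=> b k l; apply: val_inj; exact: (ms_star ms).
- move=> x _ e /(ms_dense ms (sub_inS x))[_ [r ->]] xr.
  exists (block_sum (fun b k l => sub_in hS cS (ms_in ms b k l)) id id r).
    by exists r.
  rewrite sub_nrm; apply: le_lt_trans xr; rewrite le_eqVlt; apply/orP; left.
  apply/eqP; congr (nrm (_ - _)); rewrite /block_sum.
  exact: (@big_morph _ _ (@sub_val R A S hS cS) 0 +%R 0 +%R).
Qed.

(** * Reflections *)

Section Reflections.
Variables (R : realType) (K : cstarAlgType R).

Definition is_projection (q : K) := q^# = q /\ q ** q = q.

Definition projection := {q : K | `[< is_projection q >]}.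

Variable q : K.
Hypothesis hq : is_projection q.

(* Multiplication by the unitary [1 - 2 q] of the unitization. *)
Let refl_l (k : K) := k - (q ** k + q ** k).
Let refl_r (k : K) := k - (k ** q + k ** q).

Let qs : q^# = q. Proof. by case: hq. Qed.
Let qq : q ** q = q. Proof. by case: hq. Qed.

Let refl_lM k k' : refl_l (k ** k') = refl_l k ** k'.
Proof. by rewrite /refl_l cmulBl cmulDl !cmulA. Qed.

Let refl_rM k k' : refl_r (k ** k') = k ** refl_r k'.
Proof. by rewrite /refl_r cmulBr cmulDr !cmulA. Qed.

Let refl_l_star k : (refl_l k)^# = refl_r k^#.
Proof. by rewrite /refl_l cstarB cstarD !cstarM qs. Qed.

Let refl_r_star k : (refl_r k)^# = refl_l k^#.
Proof. by rewrite /refl_r cstarB cstarD !cstarM qs. Qed.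

Let refl_lK k : refl_l (refl_l k) = k.
Proof.
rewrite /refl_l cmulBr cmulDr !cmulA qq; set t := q ** k.
have -> : t - (t + t) = - t by rewrite opprD addrA subrr sub0r.
by rewrite -opprD opprK subrK.
Qed.

Let refl_rK k : refl_r (refl_r k) = k.
Proof. by rewrite -[LHS]cstarK !refl_r_star refl_lK cstarK. Qed.

Let refl_lr k : refl_l (refl_r k) = refl_r (refl_l k).
Proof.
have dbl (x a b d : K) :
    x - (a + a) - ((b - d) + (b - d)) = x - (a + a) - (b + b) + (d + d).
  by rewrite [b - d + _]addrACA -opprD opprB [d + d - _]addrC addrA.
rewrite /refl_l /refl_r !(cmulBr, cmulBl) !(cmulDl, cmulDr) !cmulA !dbl.
by congr (_ + _); rewrite addrAC.
Qed.

Let refl_mid k k' : refl_r k ** refl_l k' = k ** k'.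
Proof.
have mid x : refl_r k ** x = k ** refl_l x.
  by rewrite /refl_r /refl_l cmulBl cmulBr cmulDl cmulDr !cmulA.
by rewrite mid refl_lK.
Qed.

Definition reflection k := refl_l (refl_r k).

Lemma reflection_linear : linear reflection.
Proof.
have dbl (c : R[i]) (u v : K) : c *: u + v + (c *: u + v) = c *: (u + u) + (v + v).
  by rewrite addrACA scalerDr.
have sub (c : R[i]) (u v u' v' : K) :
    c *: u + v - (c *: u' + v') = c *: (u - u') + (v - v').
  by rewrite opprD addrACA scalerBr.
move=> c x y; rewrite /reflection.
have -> : refl_r (c *: x + y) = c *: refl_r x + refl_r y.
  by rewrite /refl_r cmulDl cmulZl dbl sub.
by rewrite /refl_l cmulDr cmulZr dbl sub.
Qed.

Lemma reflectionM k k' : reflection (k ** k') = reflection k ** reflection k'.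
Proof.
rewrite {2}/reflection -refl_lM [reflection k']refl_lr -refl_rM.
by rewrite refl_mid.
Qed.

Lemma reflection_star k : reflection k^# = (reflection k)^#.
Proof. by rewrite /reflection refl_l_star refl_r_star refl_lr. Qed.

Lemma reflectionK : involutive reflection.
Proof. by move=> k; rewrite /reflection refl_lr refl_lK refl_rK. Qed.

Lemma reflection_nrm k : nrm (reflection k) = nrm k.
Proof.
have nl x : nrm (refl_l x) = nrm x.
  apply/eqP; rewrite -(@eqrXn2 _ 2) ?nrm_ge0// -!nrm_star refl_l_star.
  by rewrite refl_mid.
by rewrite /reflection nl -nrm_cstar refl_r_star nl nrm_cstar.
Qed.

End Reflections.

Lemma reflection0 (R : realType) (K : cstarAlgType R) (k : K) : reflection 0 k = k.
Proof. by rewrite /reflection !(cmul0l, cmul0r, addr0, subr0). Qed.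

(* Write [y = p_00 y + z].  If [p_00 y] is small, the reflection exchanging the
   range of [p_00] with the line of [z] maps [p_00] to the projection onto that
   line. *)
Lemma reflection_large (R : realType) (K : cstarAlgType R) (p : nat -> nat -> K) (y : K) :
  matrix_units p -> y ** p 0 0 = y ->
  exists2 q, is_projection q & nrm y <= 2 * nrm (reflection q (p 0 0) ** y).
Proof.
move=> pu yp; set e := p 0 0; have ee : e ** e = e by rewrite (mx_unitM pu).
have es : e^# = e by exact: (mx_unit_star pu).
(* If [e y] carries half of the norm of [y], the projection 0 will do; otherwise [z] below carries
   half of it. *)
have [big|small] := leP (nrm y) (2 * nrm (e ** y)).
  exists 0; first by split; rewrite ?cstar0 ?cmul0l.
  by rewrite reflection0.
pose z := y - e ** y; have ez : e ** z = 0 by rewrite cmulBr cmulA ee subrr.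
have ze : z ** e = z by rewrite cmulBl -cmulA yp.
have yez : y = e ** y + z by rewrite addrC subrK.
have nz : nrm y <= 2 * nrm z.
  by have := nrmD (e ** y) z; rewrite -yez; lra.
have z0 : 0 < nrm z.
  by have := nrm_ge0 (e ** y); lra.
(* As [z e = z], the element [z] has rank one, and [u] is a partial isometry from the line of [e]
   onto a line orthogonal to it. *)
pose c := (nrm z)^-1; pose u : K := c%:C *: z.
have eu : e ** u = 0 by rewrite cmulZr ez scaler0.
have ue : u ** e = u by rewrite cmulZl ze.
have us : u^# = c%:C *: z^# by rewrite cstarZ conjR.
have ue' : u^# ** e = 0 by rewrite -[LHS]cstarK cstarM cstarK es eu cstar0.
have eu' : e ** u^# = u^# by rewrite -[LHS]cstarK cstarM cstarK es ue.
have uu : u^# ** u = e.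
  have := mx_unit_pos pu z; rewrite -/e ze -[_ ** z ** e]cmulA ze -cmulA.
  have -> : e ** (z^# ** z) = z^# ** z.
    by rewrite cmulA -{1}es -cstarM ze.
  rewrite us cmulZl cmulZr scalerA => ->; rewrite scalerA -!rmorphM /=.
  rewrite (_ : c * c * nrm z ^+ 2 = 1) ?scale1r// /c.
  by field; rewrite gt_eqF.
(* This [q] projects onto the line of [e_0 + u e_0], since [f^# f = 2 e]. Up to sign, [1 - 2 q]
   exchanges [e_0] and [u e_0]. *)
pose f := e + u; pose q := (2^-1 : R)%:C *: (f ** f^#).
have fs : f^# = e + u^# by rewrite cstarD es.
have ff : f^# ** f = e + e.
  by rewrite fs cmulDl !cmulDr ee eu ue' uu addr0 add0r.
have half (x : K) : (2^-1 : R)%:C *: (x + x) = x.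
  by rewrite scalerDr -scalerDl -rmorphD /= (_ : 2^-1 + 2^-1 = 1) ?scale1r//; field.
have fe : f ** e = f by rewrite cmulDl ee ue.
have ef : e ** f^# = f^# by rewrite -[LHS]cstarK cstarM cstarK es fe.
have qproj : is_projection q.
  split; first by rewrite cstarZ conjR cstarM cstarK.
  rewrite /q cmulZl cmulZr cmulA -[f ** f^# ** f]cmulA ff cmulDr cmulDl fe.
  by rewrite half.
exists q => //; have qq2 k : q ** k + q ** k = f ** (f^# ** k).
  rewrite /q cmulZl -scalerDl -rmorphD /= (_ : 2^-1 + 2^-1 = 1); last by field.
  by rewrite scale1r cmulA.
have qq2' k : k ** q + k ** q = k ** f ** f^#.
  rewrite /q cmulZr -scalerDl -rmorphD /= (_ : 2^-1 + 2^-1 = 1); last by field.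
  by rewrite scale1r cmulA.
have re : reflection q e = u ** u^#.
  have uu0 : u^# ** u^# = 0.
    by rewrite -cstarM -{1}ue -cmulA eu cmul0r cstar0.
  have ef' : e ** f = e by rewrite cmulDr ee eu addr0.
  rewrite /reflection qq2' ef' ef fs opprD addrA subrr add0r qq2 fs.
  rewrite !cmulNr opprK [(e + u^#) ** _]cmulDl eu' uu0 addr0 cmulDl eu'.
  by rewrite addrA addNr add0r.
rewrite re (_ : u ** u^# ** y = z) //.
rewrite {1}yez cmulDr [_ ** (e ** y)]cmulA -[u ** u^# ** e]cmulA ue' cmul0r.
rewrite cmul0l add0r us -cmulA [(_ *: z^#) ** z]cmulZl.
have -> : z^# ** z = (nrm z ^+ 2)%:C *: e.
  have := mx_unit_pos pu z; rewrite -/e ze -[_ ** z ** e]cmulA ze => <-.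
  by rewrite -{1}es -cstarM ze.
rewrite scalerA cmulZr ue /u scalerA -!rmorphM /=.
by rewrite (_ : _ * _ = 1) ?scale1r// /c; field; rewrite gt_eqF.
Qed.

(** * The algebra of a tree *)

(** A coefficient that represents 0 is needed for matrices living on a branch alone; [None] is added
    for it. *)
Lemma matricial_pointed (R : realType) (C : cstarAlgType R) (S : set C) :
  S 0 -> matricial S -> exists B (m : B -> nat -> nat -> C) scl mul str b0,
    matrix_system m S scl mul str /\ forall k l, m b0 k l = 0.
Proof.
move=> S0 [B [m [scl [mul [str ms]]]]].
exists (option B), (fun b k l => if b is Some b then m b k l else 0),
  (fun c => omap (scl c)), (fun b b' => obind (fun b => omap (mul b) b') b),
  (omap str), None; split=> //; split.
- by case=> [b|] k l //; exact: (ms_in ms).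
- by move=> c [b|] k l /=; rewrite ?scaler0// (msZ ms).
- move=> [b|] k l [b'|] k' l' /=; rewrite ?cmul0l ?cmul0r ?if_same//.
  exact: (msM ms).
- by move=> [b|] k l /=; rewrite ?cstar0// (ms_star ms).
- move=> x /(ms_dense ms) Sx; apply: near_set_trans Sx _ => _ [r ->].
  apply: near_set_refl; exists [seq (Some e.1, e.2) | e <- r].
  by rewrite /block_sum big_map.
Qed.

Section TreeAlgebra.
Variables (R : realType) (K : cstarAlgType R).

Local Notation V := (projection K).
Local Notation L := (linf K (seq V)).
Implicit Types (xi eta : nat -> V) (f g : L) (x : seq V).

Definition theta (v : V) : K -> K := reflection (val v).

Let vP (v : V) : is_projection (val v).
Proof. by case: v => q /= /asboolP. Qed.

Let th_linear v : linear (theta v). Proof. exact: reflection_linear. Qed.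
Let thM v k k' : theta v (k ** k') = theta v k ** theta v k'.
Proof. exact: reflectionM (vP v) k k'. Qed.
Let th_star v k : theta v k^# = (theta v k)^#.
Proof. exact: reflection_star (vP v) k. Qed.
Let thK v : involutive (theta v). Proof. exact: reflectionK (vP v). Qed.
Let th_nrm v k : nrm (theta v k) = nrm k. Proof. exact: reflection_nrm (vP v) k. Qed.

Definition on_branch xi : pred (seq V) := fun x => x == mkseq xi (size x).

Lemma on_branch_mkseq xi m : on_branch xi (mkseq xi m).
Proof. by rewrite /on_branch size_mkseq. Qed.

Lemma branches_split xi eta : xi <> eta ->
  exists N, forall m, (N <= m)%N -> on_branch eta (mkseq xi m) = false.
Proof.
move=> ne; have [i /eqP xei] : exists i, xi i <> eta i.
  by apply/existsNP => h; apply: ne; apply/funext.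
exists i.+1 => m im; apply/negP; rewrite /on_branch size_mkseq => /eqP.
move=> /(congr1 (fun s => nth (xi i) s i)); rewrite !nth_mkseq// => /eqP.
by rewrite (negPf xei).
Qed.

(* Sections over the branch that converge in the trivialization [theta]. *)
Definition branch_algebra xi : set L := fun f =>
  (forall x, ~~ on_branch xi x -> f x = 0) /\
  exists k : K, forall e : R, 0 < e -> exists N, forall m, (N <= m)%N ->
    nrm (f (mkseq xi m) - theta (xi m) k) < e.

Local Notation D := branch_algebra.

Lemma branch_algebra_eventually xi f (k : K) N :
  (forall x, ~~ on_branch xi x -> f x = 0) ->
  (forall m, (N <= m)%N -> f (mkseq xi m) = theta (xi m) k) -> D xi f.
Proof.
move=> f0 fk; split=> //; exists k => e e0; exists N => m Nm.
by rewrite fk// subrr nrm0.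
Qed.

(** As [theta] is an isometric involution, the twist may be moved from the limit to the function;
    limits of products and adjoints then apply. *)
Let tends_theta xi f k : (forall e : R, 0 < e -> exists N, forall m, (N <= m)%N ->
    nrm (f (mkseq xi m) - theta (xi m) k) < e) <->
  tends (fun m => theta (xi m) (f (mkseq xi m))) k.
Proof.
have E m : nrm (theta (xi m) (f (mkseq xi m)) - k) =
    nrm (f (mkseq xi m) - theta (xi m) k).
  by rewrite -{1}(thK (xi m) k) -(linB (th_linear _)) th_nrm.
by split=> h e /h[N Nh]; exists N => m /Nh; rewrite E.
Qed.

Lemma branch_star_subalgebra xi : star_subalgebra (D xi).
Proof.
split.
- move=> c f g [f0 [k /tends_theta fk]] [g0 [l /tends_theta gl]]; split.
    by move=> x nx; rewrite linf_addE linf_scaleE f0// g0// scaler0 addr0.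
  exists (c *: k + l); apply/tends_theta; have := tendsD (tendsZ c fk) gl.
  by under eq_fun do rewrite -th_linear.
- by apply: (@branch_algebra_eventually _ _ 0 0) => // m _; rewrite (lin0 (th_linear _)).
- move=> f g [f0 [k /tends_theta fk]] [g0 [l /tends_theta gl]]; split.
    by move=> x nx; rewrite linf_mulE f0// cmul0l.
  exists (k ** l); apply/tends_theta; have := tends_cmul fk gl.
  by under eq_fun do rewrite -thM.
- move=> f [f0 [k /tends_theta fk]]; split.
    by move=> x nx; rewrite linf_starE f0// cstar0.
  exists k^#; apply/tends_theta; have := tends_cstar fk.
  by under eq_fun do rewrite -th_star.
Qed.

Lemma branch_algebraM xi eta f g : D xi f -> D eta g -> D xi (f ** g) /\ D xi (g ** f).
Proof.
have [<-|ne] := pselect (xi = eta).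
  by move=> Df Dg; split; apply: (subM (branch_star_subalgebra xi)).
move=> [f0 _] [g0 _]; have [N Ng] := branches_split ne.
have gN m : (N <= m)%N -> g (mkseq xi m) = 0 by move=> /Ng nm; rewrite g0 ?nm.
split; apply: (@branch_algebra_eventually _ _ 0 N).
- by move=> x nx; rewrite linf_mulE f0// cmul0l.
- by move=> m Nm; rewrite linf_mulE gN// cmul0r (lin0 (th_linear _)).
- by move=> x nx; rewrite linf_mulE f0// cmul0r.
- by move=> m Nm; rewrite linf_mulE gN// cmul0l (lin0 (th_linear _)).
Qed.

Inductive branch_span : L -> Prop :=
| branch_span0 : branch_span 0
| branch_spanD xi d f : D xi d -> branch_span f -> branch_span (d + f).

Local Notation S := branch_span.

Lemma branch_span_in xi d : D xi d -> S d.
Proof. by move=> Dd; rewrite -[d]addr0; apply: branch_spanD Dd branch_span0. Qed.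

Let SD f g : S f -> S g -> S (f + g).
Proof.
move=> Sf Sg; elim: Sf => [|xi d h Dd _ IH]; rewrite ?add0r// -addrA.
exact: branch_spanD Dd IH.
Qed.

Lemma branch_spanM xi d f : S f -> D xi d -> D xi (f ** d) /\ D xi (d ** f).
Proof.
have hD := branch_star_subalgebra xi; move=> Sf Dd.
elim: Sf => [|eta c h Dc _ [IHl IHr]].
  by rewrite cmul0l cmul0r; split; exact: sub0 hD.
have [cl cr] := branch_algebraM Dd Dc.
by rewrite cmulDl cmulDr; split; rewrite -[X in X + _]scale1r; apply: (sub_linear hD).
Qed.

Lemma branch_span_star_subalgebra : star_subalgebra S.
Proof.
split.
- move=> c f g Sf Sg; apply: SD => //; elim: Sf => [|xi d h Dd _ IH].
    by rewrite scaler0; exact: branch_span0.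
  rewrite scalerDr; apply: branch_spanD IH; rewrite -[_ *: d]addr0.
  have hD := branch_star_subalgebra xi.
  by apply: (sub_linear hD) => //; exact: (sub0 hD).
- exact: branch_span0.
- move=> f g Sf Sg; elim: Sg => [|xi d h Dd _ IH].
    by rewrite cmul0r; exact: branch_span0.
  by rewrite cmulDr; apply: branch_spanD IH; exact: (branch_spanM Sf Dd).1.
- move=> f; elim=> [|xi d h Dd _ IH]; first by rewrite cstar0; exact: branch_span0.
  by rewrite cstarD; apply: branch_spanD IH; exact: (sub_star (branch_star_subalgebra xi)).
Qed.

Definition tree_alg := sub_alg (near_star_subalgebra branch_span_star_subalgebra)
  (@near_near_set _ _ _).

HB.instance Definition _ := CstarAlg.on tree_alg.

Local Notation A := tree_alg.

Let toA f (Sf : near_set S f) : A :=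
  sub_in (near_star_subalgebra branch_span_star_subalgebra) (@near_near_set _ _ _) Sf.

Let AS (a : A) : near_set S (sub_val a). Proof. exact: sub_inS. Qed.

(** * Restriction to a branch and to its complement *)

Section Restriction.
Variable xi : nat -> V.

Let rst_bound (b : bool) f x : nrm (if on_branch xi x == b then f x else 0) <= nrm f.
Proof. by case: ifP => _; rewrite ?nrm0 ?nrm_ge0 ?linf_ge. Qed.

Definition restrict b f : L := linf_of (rst_bound b f).

Lemma restrict_linear b : linear (restrict b).
Proof.
move=> c f g; apply: linfP => x; rewrite linf_addE linf_scaleE /=.
by case: ifP => _; rewrite ?scaler0 ?addr0.
Qed.

Lemma restrict_lip b : lip (restrict b).
Proof.
apply: (@lip_linear _ _ _ _ 1) => // [|f]; first exact: restrict_linear.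
by rewrite mul1r; apply: linf_le => [|x]; [exact: nrm_ge0 | exact: rst_bound].
Qed.

Lemma restrict_split f : f = restrict false f + restrict true f.
Proof.
by apply: linfP => x; rewrite linf_addE /=; case: on_branch; rewrite /= ?addr0 ?add0r.
Qed.

(** A section over another branch leaves on [xi] only finitely many values, and these form a section
    over [xi] with limit 0. *)
Lemma restrict_span f : S f -> D xi (restrict true f).
Proof.
have hD := branch_star_subalgebra xi.
elim=> [|eta d h Dd _ IH].
  by rewrite (lin0 (restrict_linear true)); exact: (sub0 hD).
rewrite (linD (restrict_linear true)) -[X in X + _]scale1r.
apply: (sub_linear hD) => //.
have off x : ~~ on_branch xi x -> restrict true d x = 0.
  by move=> /negPf nx; rewrite /= nx.
have [ex|ne] := pselect (xi = eta).
  split=> //; rewrite -ex in Dd; have [_ [k dk]] := Dd.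
  exists k => e /dk[N Nk]; exists N => m /Nk.
  by rewrite /= on_branch_mkseq.
have [N Nd] := branches_split ne; have [d0 _] := Dd.
apply: (@branch_algebra_eventually _ _ 0 N) => // m /Nd nm.
by rewrite /= on_branch_mkseq d0 ?nm// (lin0 (th_linear _)).
Qed.

End Restriction.

(** * The tree algebra is not stable; a branch can be adjoined to a stable ideal *)

Section Units.
Variable p : nat -> nat -> K.
Hypothesis pu : matrix_units p.

Let sec_bound xi (c : nat -> R[i]) (M : R) (cM : forall m, normc (c m) <= M) (k : K) x :
  nrm (if on_branch xi x then c (size x) *: theta (xi (size x)) k else 0) <= M * nrm k.
Proof.
have M0 : 0 <= M by apply: le_trans (cM 0); exact: normc_nneg.
case: ifP => _; last by rewrite nrm0 mulr_ge0 ?nrm_ge0.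
by rewrite nrmZ th_nrm ler_wpM2r ?nrm_ge0.
Qed.

(** The nodes of the branch that follows [F]: its next letter is the value of [F] at the node
    reached so far. *)
Definition prefix_choice (F : seq V -> V) m : seq V :=
  iter m (fun x => rcons x (F x)) [::].

Lemma prefix_choiceE F m : mkseq (fun i => F (prefix_choice F i)) m = prefix_choice F m.
Proof. by elim: m => // m IH; rewrite mkseqS IH. Qed.

Let zeroV : V.
Proof.
by exists 0; apply/asboolP; split; rewrite ?cstar0 ?cmul0l.
Qed.

(* Given a matrix system of [A], pick at the point [x] of level [n] an element
   [y] of the corner [e_nn A e_nn] at [x] and a reflection [F x] such that
   [theta (F x) (p 0 0) y] is large.  The section [theta (xi m) (p 0 0)] along
   the branch [xi] following [F] cannot be approximated by a finite matrix,
   since the latter kills [y] for [n] large. *)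
Lemma tree_alg_not_matricial : ~ matricial [set: A].
Proof.
move=> [B [m [scl [mul [str ms]]]]].
pose u b k l x : K := sub_val (m b k l) x.
have uM b k l b' k' l' x : u b k l x ** u b' k' l' x =
    if l == k' then u (mul b b') k l' x else 0.
  rewrite -[LHS]/(sub_val (m b k l ** m b' k' l') x) (msM ms).
  by case: ifP.
have ust b k l x : (u b k l x)^# = u (str b) l k x.
  by rewrite -[LHS]/(sub_val (m b k l)^# x) (ms_star ms).
have p00 : nrm (p 0 0) = 1 := mx_unit_nrm pu.
(* If all diagonal values at [(n, n)] vanished at [x], the C*-identity would kill first the row [n]
   and then every entry at [x]. But the algebra contains functions supported at the single node
   [x]. *)
have unz n x : exists b, u b n n x != 0.
  apply: contrapT => /forallNP u0.
  have {}u0 b : u b n n x = 0 by apply/eqP/negPn/negP; exact: u0.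
  have row b l : u b n l x = 0.
    apply: nrm0_eq0; apply/eqP; rewrite -sqrf_eq0 -nrm_starr ust uM eqxx u0.
    by rewrite nrm0.
  have all0 b k l : u b k l x = 0.
    apply: nrm0_eq0; apply/eqP; rewrite -sqrf_eq0 -nrm_star ust uM eqxx.
    by have := uM (str b) l n b n l x; rewrite eqxx row cmul0r => <-; rewrite nrm0.
  (* Any branch through [x] would do; this one goes on with the projection 0. *)
  pose xi i := nth zeroV x i.
  have xxi : on_branch xi x by rewrite /on_branch /xi mkseq_nth.
  have bound y : nrm (if y == x then p 0 0 else 0) <= 1.
    by case: ifP => _; rewrite ?p00 ?nrm0.
  pose f : L := linf_of bound.
  have Df : D xi f.
    apply: (@branch_algebra_eventually _ _ 0 (size x).+1) => [y|n' nx].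
      by rewrite /=; case: eqP => // ->; rewrite xxi.
    rewrite /= (lin0 (th_linear _)); case: eqP => // /(congr1 size).
    by rewrite size_mkseq => n'x; move: nx; rewrite n'x ltnn.
  have [|_ [r ->]] := ms_dense ms I (t := toA (near_set_refl (branch_span_in Df))) (e := 1).
    exact: ltr01.
  rewrite sub_nrm; apply/negP; rewrite -leNgt.
  apply: le_trans (linf_ge _ x).
  have bs0 : (sub_val (block_sum m id id r) : L) x = 0.
    have -> : (sub_val (block_sum m id id r) : L) x = \sum_(e <- r) u e.1 e.2.1 e.2.2 x.
      exact: (@big_morph _ _ (fun a : A => (sub_val a : L) x) 0 +%R 0 +%R).
    by rewrite big1.
  rewrite -[X in nrm X]/(f x - (sub_val (block_sum m id id r) : L) x) bs0 subr0.
  by rewrite /= eqxx p00.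
have step x : exists vbj : V * (B * nat),
    let y := u vbj.2.1 (size x) (size x) x ** p vbj.2.2 0 in
    0 < nrm y /\ nrm y <= 2 * nrm (theta vbj.1 (p 0 0) ** y).
  have [b bx] := unz (size x) x; set s := u b _ _ x in bx.
  (* A nonzero column of [s], moved to column 0, has the rank-one form that [reflection_large] asks
     for. *)
  have [j sj] : exists j, s ** p j 0 != 0.
    apply: contrapT => /forallNP s0; move/negP: bx; apply; apply/eqP.
    apply: (entry_eq0 pu) => i j; apply: (entry_unique pu).
    have {}s0 : s ** p j 0 = 0 by apply/eqP/negPn/negP; exact: s0.
    have -> : p j j = p j 0 ** p 0 j by rewrite (mx_unitM pu) eqxx.
    by rewrite -cmulA [s ** _]cmulA s0 cmul0l cmul0r scale0r.
  have [|q qproj qy] := @reflection_large _ _ p (s ** p j 0) pu.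
    by rewrite -cmulA (mx_unitM pu) eqxx.
  have qP : `[< is_projection q >] by apply/asboolP.
  by exists (exist _ q qP, (b, j)); split=> //=; exact: nrm_gt0.
have [F FP] := choice step.
pose G x := (F x).1; pose xi i := G (prefix_choice G i).
have bound x : nrm (if on_branch xi x then theta (xi (size x)) (p 0 0) else 0) <= 1.
  by case: ifP => _; rewrite ?th_nrm ?p00 ?nrm0.
pose g : L := linf_of bound.
have Dg : D xi g.
  apply: (@branch_algebra_eventually _ _ (p 0 0) 0) => [x /negPf nx|m' _].
    by rewrite /= nx.
  by rewrite /= on_branch_mkseq size_mkseq.
(* Any tolerance below 1/2 contradicts the factor 2 of [reflection_large]. *)
have [|_ [r ->]] := ms_dense ms I (t := toA (near_set_refl (branch_span_in Dg))) (e := 4^-1).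
  by rewrite invr_gt0.
rewrite sub_nrm => gr.
(* This [n] exceeds all column indices of [r], so at the node of level [n] the finite matrix
   annihilates [y], whose left factor lies in the corner [(n, n)]. *)
pose n := (\max_(e <- r) e.2.2).+1; pose x := prefix_choice G n.
have xE : x = mkseq xi n by rewrite prefix_choiceE.
have sx : size x = n by rewrite xE size_mkseq.
have [y0 yle] := FP x; rewrite sx in y0 yle.
set y := u _ n n x ** _ in y0 yle.
have gx : g x = theta (G x) (p 0 0).
  by rewrite /= sx {1}xE on_branch_mkseq.
pose h : K := \sum_(e <- r) u e.1 e.2.1 e.2.2 x.
have hy : h ** y = 0.
  have : (\max_(e <- r) e.2.2 < n)%N by [].
  rewrite /h; elim: (r) => [|e r' IH]; first by move=> _; rewrite big_nil cmul0l.
  rewrite !big_cons gtn_max => /andP[en /IH r'n].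
  by rewrite cmulDl r'n addr0 /y cmulA uM ifN ?cmul0l// ltn_eqF.
have bsE : (sub_val (block_sum m id id r) : L) x = h.
  exact: (@big_morph _ _ (fun a : A => (sub_val a : L) x) 0 +%R 0 +%R).
have gh : nrm (g x - h) <= 4^-1.
  rewrite -bsE; apply: ltW; apply: le_lt_trans gr.
  exact: (linf_ge (g - (sub_val (block_sum m id id r) : L)) x).
have := nrmM (g x - h) y; rewrite cmulBl hy subr0 gx.
have : nrm (g x - h) * nrm y <= 4^-1 * nrm y by rewrite ler_pM2r.
by rewrite gx; lra.
Qed.

(** * Adjoining a branch to a stable ideal *)

Section Extension.
Variable xi : nat -> V.

(** The scalar coefficients along the branch. They are closed under products and conjugation, give
    convergent sections, and still allow an arbitrary change at finitely many nodes. *)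
Record evconst := EvConst {
  ev_fun :> nat -> R[i];
  ev_funP : exists N c, forall n, (N <= n)%N -> ev_fun n = c }.

Let ev_bound (c : evconst) : exists M : R, forall n, normc (c n) <= M.
Proof.
have [N [a ca]] := ev_funP c.
have nonneg := @normc_nneg R.
exists (\sum_(i < N) normc (c i) + normc a) => n.
have [Nn|nN] := leqP N n; first by rewrite ca// lerDr sumr_ge0.
by rewrite (bigD1 (Ordinal nN))//= -addrA lerDl addr_ge0// sumr_ge0.
Qed.

Let section_bound (c : evconst) k : exists M : R, forall x,
  nrm (if on_branch xi x then c (size x) *: theta (xi (size x)) k else 0) <= M.
Proof. by have [M cM] := ev_bound c; exists (M * nrm k); exact: sec_bound. Qed.

Definition branch_section (c : evconst) k : L :=
  Linf (asboolT (section_bound c k) : (fun x => if on_branch xi x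
    then c (size x) *: theta (xi (size x)) k else 0) \in @bounded_map R K (seq V)).

Local Notation W := branch_section.

Let ev_mul_subproof (c c' : evconst) :
  exists N b, forall n, (N <= n)%N -> c n * c' n = b.
Proof.
have [N [a ca]] := ev_funP c; have [N' [a' ca']] := ev_funP c'.
exists (maxn N N'), (a * a') => n; rewrite geq_max => /andP[Nn Nn'].
by rewrite ca// ca'.
Qed.

Let ev_map_subproof (h : R[i] -> R[i]) (c : evconst) :
  exists N b, forall n, (N <= n)%N -> h (c n) = b.
Proof. by have [N [a ca]] := ev_funP c; exists N, (h a) => n /ca->. Qed.

Let ev_mul c c' := EvConst (ev_mul_subproof c c').
Let ev_map h c := EvConst (ev_map_subproof h c).

Let W_in c k : D xi (W c k).
Proof.
have [N [a ca]] := ev_funP c.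
apply: (@branch_algebra_eventually _ _ (a *: k) N) => [x /negPf nx|m Nm].
  by rewrite /= nx.
by rewrite /= on_branch_mkseq size_mkseq ca// (linZ (th_linear _)).
Qed.

Let sub1D (Z : set L) f g : star_subalgebra Z -> Z f -> Z g -> Z (f + g).
Proof. by move=> hZ Zf Zg; rewrite -[f]scale1r; exact: (sub_linear hZ). Qed.

Let subN (Z : set L) f : star_subalgebra Z -> Z f -> Z (- f).
Proof.
by move=> hZ Zf; rewrite -[- f]addr0 -scaleN1r; apply: (sub_linear hZ) => //; exact: (sub0 hZ).
Qed.

Variable I : set L.
Hypotheses (hI : star_subalgebra I) (IS : I `<=` near_set S).
Hypothesis IM : forall f g, I f -> near_set S g -> I (f ** g) /\ I (g ** f).

Definition adjoin_branch : set L := [set h | exists i d, [/\ I i, D xi d & h = i + d]].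

Let hD := branch_star_subalgebra xi.

Let extI i : I i -> adjoin_branch i.
Proof. by move=> Ii; exists i, 0; split; [|exact: (sub0 hD)|rewrite addr0]. Qed.

Let extD d : D xi d -> adjoin_branch d.
Proof. by move=> Dd; exists 0, d; split; [exact: (sub0 hI)|exact: Dd|rewrite add0r]. Qed.

Let D_near d : D xi d -> near_set S d.
Proof. by move=> Dd; apply: near_set_refl; exact: branch_span_in Dd. Qed.

Lemma adjoin_branch_star_subalgebra : star_subalgebra adjoin_branch.
Proof.
split.
- move=> c _ _ [i [d [Ii Dd ->]]] [i' [d' [Ii' Dd' ->]]].
  exists (c *: i + i'), (c *: d + d'); split; first exact: (sub_linear hI).
    exact: (sub_linear hD).
  by rewrite scalerDr addrACA.
- exact: extI (sub0 hI).
- move=> _ _ [i [d [Ii Dd ->]]] [i' [d' [Ii' Dd' ->]]].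
  exists (i ** i' + i ** d' + d ** i'), (d ** d'); split.
  + apply: sub1D => //; last exact: (IM Ii' (D_near Dd)).2.
    by apply: sub1D => //; [exact: (subM hI) | exact: (IM Ii (D_near Dd')).1].
  + exact: (subM hD).
  + by rewrite cmulDr !cmulDl !addrA; congr (_ + _); rewrite addrAC.
- move=> _ [i [d [Ii Dd ->]]]; exists i^#, d^#; split; rewrite ?cstarD//.
    exact: (sub_star hI).
  exact: (sub_star hD).
Qed.

Let restrict_near f : near_set S f -> near_set (D xi) (restrict xi true f).
Proof. by apply: near_set_lip (restrict_lip xi true) _ => g; exact: restrict_span. Qed.

Lemma adjoin_branch_ideal f h : near_set S f -> near_set adjoin_branch h ->
  near_set adjoin_branch (f ** h) /\ near_set adjoin_branch (h ** f).
Proof.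
move=> Sf Eh; split.
  apply: near_near_set; apply: (near_set_lip (lip_cmull f (@lip_id _ _)) _ Eh).
  move=> _ [i [d [Ii Dd ->]]] /=; rewrite cmulDr.
  apply: (near_setD (S := I) (S' := D xi)) => [u v Iu Dv||].
  - by exists u, v.
  - exact: near_set_refl (IM Ii Sf).2.
  - apply: (near_set_lip (lip_cmulr d (@lip_id _ _)) _ Sf) => g Sg.
    exact: (branch_spanM Sg Dd).1.
apply: near_near_set; apply: (near_set_lip (lip_cmulr f (@lip_id _ _)) _ Eh).
move=> _ [i [d [Ii Dd ->]]] /=; rewrite cmulDl.
apply: (near_setD (S := I) (S' := D xi)) => [u v Iu Dv||].
- by exists u, v.
- exact: near_set_refl (IM Ii Sf).1.
- apply: (near_set_lip (lip_cmull d (@lip_id _ _)) _ Sf) => g Sg.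
  exact: (branch_spanM Sg Dd).2.
Qed.

(* Off the branch the matrix system of [I], on the branch the one given by the
   trivialization: a single branch meets every other one in a finite set. *)
Lemma adjoin_branch_matricial : matricial I -> matricial (near_set adjoin_branch).
Proof.
move=> /(matricial_pointed (sub0 hI))[B [m [scl [mul [str [b0 [ms mb0]]]]]]].
pose mJ (b : B * evconst) k l : L := restrict xi false (m b.1 k l) + W b.2 (p k l).
have mJE b k l x : mJ b k l x = if on_branch xi x
    then b.2 (size x) *: theta (xi (size x)) (p k l) else m b.1 k l x.
  by rewrite linf_addE /=; case: (on_branch xi x); rewrite ?add0r ?addr0.
exists (B * evconst)%type, mJ, (fun c b => (scl c b.1, ev_map ( *%R c) b.2)),
  (fun b b' => (mul b.1 b'.1, ev_mul b.2 b'.2)),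
  (fun b => (str b.1, ev_map Num.conj b.2)).
have hE := near_star_subalgebra adjoin_branch_star_subalgebra.
split.
- move=> b k l; have Im : I (m b.1 k l) := ms_in ms _ _ _.
  rewrite /mJ; apply: (sub1D hE); last by apply: near_set_refl; exact/extD/W_in.
  (* The part off the branch need not lie in [I]; it differs from an element of [I] by a limit of
     sections over [xi]. *)
  have -> : restrict xi false (m b.1 k l) = m b.1 k l - restrict xi true (m b.1 k l).
    by rewrite {2}(restrict_split xi (m b.1 k l)) addrK.
  apply: (sub1D hE); first by apply: near_set_refl; exact: extI.
  apply: (subN hE); apply: near_set_trans (restrict_near (IS Im)) _ => d Dd.
  by apply: near_set_refl; exact: extD.
- move=> c b k l; apply: linfP => x; rewrite linf_scaleE !mJE /=.
  by case: ifP => _; rewrite ?scalerA// (msZ ms).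
- move=> b k l b' k' l'; apply: linfP => x; rewrite linf_mulE !mJE.
  rewrite (_ : (if l == k' then mJ _ k l' else 0) x =
    if l == k' then mJ (mul b.1 b'.1, ev_mul b.2 b'.2) k l' x else 0); last by case: ifP.
  rewrite mJE; case: (on_branch xi x).
    rewrite cmulZl cmulZr -thM (mx_unitM pu) scalerA.
    by case: ifP => // _; rewrite (lin0 (th_linear _)) scaler0.
  by rewrite -linf_mulE (msM ms); case: ifP.
- move=> b k l; apply: linfP => x; rewrite linf_starE !mJE.
  case: (on_branch xi x); last by rewrite -linf_starE (ms_star ms).
  by rewrite cstarZ -th_star (mx_unit_star pu).
pose Z := [set x | exists r, x = block_sum mJ id id r].
have Z0 : Z 0 by exists [::]; rewrite /block_sum big_nil.
have ZD f g : Z f -> Z g -> Z (f + g).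
  by move=> [r ->] [r' ->]; exists (r ++ r'); rewrite /block_sum big_cat.
have Zm b k l : Z (mJ b k l).
  by exists [:: (b, (k, l))]; rewrite /block_sum big_seq1.
have offI i : I i -> near_set Z (restrict xi false i).
  move=> /(ms_dense ms) Ii; apply: near_set_lip (restrict_lip xi false) _ Ii => _ [r ->].
  rewrite /block_sum (lin_sum (restrict_linear xi false)); apply: big_ind => // e _.
  have ev0 : exists N c, forall n, (N <= n)%N -> (0 : R[i]) = c by exists 0%N, 0.
  rewrite (_ : restrict _ _ _ = mJ (e.1, @EvConst (fun=> 0) ev0) (id e.2.1) (id e.2.2)).
    exact: Zm.
  by apply: linfP => x; rewrite mJE /=; case: (on_branch xi x); rewrite /= ?scale0r.
have onD d : D xi d -> near_set Z d.
  move=> [d0 [k dk]] e e0.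
  have e2 : 0 < e / 2 by rewrite divr_gt0.
  have e4 : 0 < e / 4 by rewrite divr_gt0.
  have [N dN] := dk _ e4; have [k' [n nk'] kk'] := corner_near pu k e4.
  have appr m' : exists kn : K * nat, corner p kn.2 kn.1 /\
      nrm (theta (xi m') (d (mkseq xi m')) - kn.1) < e / 2.
    have [a [n' na] da] := corner_near pu (theta (xi m') (d (mkseq xi m'))) e2.
    by exists (a, n').
  have [kn knP] := choice appr.
  (* The values at the first [N] nodes are approximated one by one, all later ones by the single
     [k'] in the trivialization. So the entries of [kappa] are eventually constant, and [M] is a
     common size for these finitely many matrices. *)
  pose kappa m' := if (m' < N)%N then (kn m').1 else k'.
  pose M := (\sum_(i < N) (kn i).2 + n)%N.
  have kM m' : corner p M (kappa m').
    rewrite /kappa; case: ltnP => [mN|_]; last by apply: corner_le nk'; rewrite // leq_addl.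
    apply: corner_le (knP m').1 => //.
    by apply: leq_trans (leq_addr _ _); rewrite (bigD1 (Ordinal mN))//= leq_addr.
  have evk i j : exists N c, forall m', (N <= m')%N -> entry p (kappa m') i j = c.
    by exists N, (entry p k' i j) => m'; rewrite /kappa ltnNge => ->.
  (* The coefficient [b0] makes [z] vanish off the branch. *)
  pose z := \sum_(i < M) \sum_(j < M) mJ (b0, EvConst (evk i j)) i j.
  exists z; first by apply: big_ind => // i _; apply: big_ind.
  apply: (@le_lt_trans _ _ (e / 2)); last by lra.
  apply: linf_le => [|x]; first exact: ltW.
  have zE : z x = if on_branch xi x then theta (xi (size x)) (kappa (size x)) else 0.
    rewrite /z linf_sumE; under eq_bigr => i _ do rewrite linf_sumE.
    under eq_bigr => i _ do under eq_bigr => j _ do rewrite mJE mb0 /=.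
    case: (on_branch xi x); last by rewrite big1// => i _; rewrite big1.
    rewrite [X in theta _ X](cornerE pu (kM _)) (lin_sum (th_linear _)).
    apply: eq_bigr => i _; rewrite (lin_sum (th_linear _)); apply: eq_bigr => j _.
    by rewrite (linZ (th_linear _)).
  rewrite linf_subE zE; case: ifPn => [xb|nx]; last first.
    by rewrite d0// subrr nrm0 ltW.
  have -> : x = mkseq xi (size x) by apply/eqP.
  rewrite size_mkseq /kappa; set m' := size x; case: ltnP => [_|Nm].
    by rewrite -(thK (xi m') (d _)) -(linB (th_linear _)) th_nrm ltW// (knP m').2.
  apply: le_trans (nrm_tri (theta (xi m') k) _ _) _.
  by rewrite -(linB (th_linear _)) th_nrm; have := dN m' Nm; lra.
have near_onD d : near_set (D xi) d -> near_set Z d.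
  by move=> Dd; exact: near_set_trans Dd onD.
move=> f Ef; apply: near_set_trans Ef _ => _ [i [d [Ii Dd ->]]].
(* The part of [i] on the branch is joined to [d]. *)
rewrite (restrict_split xi i) -addrA; apply: (near_setD ZD); first exact: offI.
apply: near_onD; apply: near_setD (restrict_near (IS Ii)) (near_set_refl Dd) => u v.
exact: sub1D.
Qed.

End Extension.

End Units.
End TreeAlgebra.

(** * There is no maximal stable ideal *)

Section NoMaximal.
Variables (R : realType) (K : cstarAlgType R).
Variables (rho : K -> ell2 R -> ell2 R) (p : nat -> nat -> K).
Hypotheses (Krho : is_compact_operators rho) (pu : matrix_units p).

Local Notation V := (projection K).
Local Notation L := (linf K (seq V)).
Local Notation A := (tree_alg K).
Local Notation S := (@branch_span R K).
Local Notation D := (@branch_algebra R K).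

Let toA f (Sf : near_set S f) : A :=
  sub_in (near_star_subalgebra (@branch_span_star_subalgebra R K)) (@near_near_set _ _ _) Sf.

Let AS (a : A) : near_set S (sub_val a). Proof. exact: sub_inS. Qed.

Lemma tree_alg_no_maximal : ~ exists I : set A, maximal_in (@stable_ideal R A) I.
Proof.
move=> [I [[[cI I0 Il IM] [B [iota [[im inrm ir] stB]]]] maxI]].
move/closed_nrm: cI => cI.
(* Adjoining a branch takes place among all bounded functions, so the ideal is moved there, and the
   enlarged ideal [J] is pulled back. *)
pose IL : set L := [set f | exists2 a : A, I a & sub_val a = f].
have fm : star_morphism (fun b => sub_val (iota b) : L).
  have [lv vM vs] := sub_val_morphism (near_star_subalgebra (@branch_span_star_subalgebra R K))
    (@near_near_set _ _ _).
  have [li iM iS] := im; split.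
  - by move=> c x y; rewrite li lv.
  - by move=> x y; rewrite iM vM.
  - by move=> x; rewrite iS vs.
have ILE : IL = range (fun b => sub_val (iota b) : L).
  apply/seteqP; split=> [_ [a Ia <-]|_ [b _ <-]].
    by move: Ia; rewrite -ir => -[b _ <-]; exists b.
  by exists (iota b) => //; rewrite -ir; exists b.
have ILm : matricial IL by rewrite ILE; exact: stable_matricial stB fm.
have hIL : star_subalgebra IL.
  have [lf fM fs] := fm; rewrite ILE; split.
  - by move=> c _ _ [b _ <-] [b' _ <-]; exists (c *: b + b'); rewrite ?lf.
  - by exists 0; rewrite ?(lin0 lf).
  - by move=> _ _ [b _ <-] [b' _ <-]; exists (b ** b'); rewrite ?fM.
  - by move=> _ [b _ <-]; exists (b^#); rewrite ?fs.
have ILS : IL `<=` near_set S by move=> _ [a _ <-]; exact: AS.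
have ILM f g : IL f -> near_set S g -> IL (f ** g) /\ IL (g ** f).
  move=> [a Ia <-] Sg; have [gl gr] := IM (toA Sg) a Ia.
  by split; [exists (a ** toA Sg) | exists (toA Sg ** a)].
have DI xi d (Dd : D xi d) : I (toA (near_set_refl (branch_span_in Dd))).
  pose E := adjoin_branch xi IL.
  have hE := near_star_subalgebra (adjoin_branch_star_subalgebra xi hIL ILM).
  have cE := @near_near_set _ _ E.
  have ES f : near_set E f -> near_set S f.
    move=> Ef; apply: near_set_trans Ef _ => _ [i [d' [ILi Dd' ->]]].
    apply: (near_setD (S := S) (S' := S)) => [u v Su Sv||]; last 1 first.
    - by apply: near_set_refl; exact: branch_span_in Dd'.
    - rewrite -[u]scale1r.
      exact: (sub_linear (branch_span_star_subalgebra K)).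
    - exact: ILS.
  pose J : set A := [set a | near_set E (sub_val a)].
  pose BJ := sub_alg hE cE.
  pose jota (b : BJ) : A := toA (ES _ (sub_inS b)).
  have IJ : I `<=` J.
    move=> a Ia; apply: near_set_refl; exists (sub_val a), 0; split.
    - by exists a.
    - exact: sub0 (branch_star_subalgebra xi).
    - by rewrite addr0.
  have stJ : stable_ideal J.
    split.
      split.
      - apply/closed_nrm => a Ja; apply: (@near_near_set _ _ E).
        apply: (near_set_lip (f := fun a : A => sub_val a : L)) Ja => //.
        exact: star_morphism_lip (sub_val_morphism _ _).
      - by apply: IJ.
      - move=> c x y Jx Jy.
        change (near_set E (c *: (sub_val x : L) + (sub_val y : L))).
        exact: (sub_linear hE _ Jx Jy).
      - move=> a x Jx; have := adjoin_branch_ideal ILM (AS a) Jx.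
        exact.
    exists BJ, jota; split.
      split.
      - by split=> [c x y|x y|x]; apply: val_inj.
      - by [].
      - apply/seteqP; split=> [_ [b _ <-]|a Ja]; first exact: sub_inS b.
        by exists (sub_in hE cE Ja) => //; exact: val_inj.
    apply: (matricial_stable Krho pu); apply: matricial_sub.
    exact: (adjoin_branch_matricial pu).
  rewrite -(maxI J stJ IJ); apply: near_set_refl; exists 0, d; split => //.
    exact: sub0 hIL.
  by rewrite add0r.
have spanI f (Sf : S f) : I (toA (near_set_refl Sf)).
  (* Passing to the underlying function removes the proof carried by [toA], which would block the
     induction on [Sf]. *)
  suff [a Ia af] : exists2 a : A, I a & sub_val a = f.
    by rewrite (_ : toA _ = a)//; apply: val_inj.
  elim: Sf => [|xi d h Dd _ [a Ia ah]]; first by exists 0.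
  exists (1 *: toA (near_set_refl (branch_span_in Dd)) + a); first exact: Il (DI _ _ Dd) Ia.
  by rewrite scale1r -ah.
(* The ideal is closed and contains the dense span of the sections. The inclusion [iota] is then
   onto, so [A] itself would have a matrix system. *)
have IT : I = [set: A].
  apply/seteqP; split=> // a _; apply: cI => e e0.
  have [f Sf af] := AS a e0.
  by exists (toA (near_set_refl Sf)).
by apply: (tree_alg_not_matricial pu); rewrite -IT -ir; exact: stable_matricial stB im.
Qed.

End NoMaximal.

(** * The zero algebra and the conclusion *)

Definition zero_alg (R : realType) := 'rV[R[i]]_0.

HB.instance Definition _ (R : realType) := GRing.Lmodule.on (zero_alg R).

Section ZeroAlgebra.
Variable R : realType.

Let zero_eq (x y : zero_alg R) : x = y. Proof. by rewrite [x]thinmx0 [y]thinmx0. Qed.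

Let zero_nrmD (x y : zero_alg R) : 0 <= 0 + 0 :> R. Proof. by rewrite addr0. Qed.

Let zero_nrmZ (c : R[i]) (x : zero_alg R) : 0 = normc c * 0. Proof. by rewrite mulr0. Qed.

Let zero_nrmM (x y : zero_alg R) : 0 <= 0 * 0 :> R. Proof. by rewrite mulr0. Qed.

Let zero_nrm_star (x : zero_alg R) : 0 = 0 ^+ 2 :> R. Proof. by rewrite expr0n. Qed.

Let zero_complete (u : nat -> zero_alg R) :
  (forall e : R, 0 < e -> exists N, forall m n, (N <= m)%N -> (N <= n)%N -> 0 < e) ->
  exists x : zero_alg R, forall e : R, 0 < e -> exists N, forall n, (N <= n)%N -> 0 < e.
Proof. by exists 0 => e e0; exists 0%N. Qed.

HB.instance Definition _ := @Lmodule_isCstarAlg.Build R (zero_alg R) (fun=> 0)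
  zero_nrmD zero_nrmZ (fun _ _ => zero_eq _ _) zero_complete
  (fun _ _ => 0) (fun _ => 0)
  (fun _ _ _ => zero_eq _ _) (fun _ _ _ => zero_eq _ _) (fun _ _ _ => zero_eq _ _)
  (fun _ _ _ => zero_eq _ _) (fun _ _ _ => zero_eq _ _) (fun _ _ => zero_eq _ _)
  (fun _ _ => zero_eq _ _) (fun _ _ => zero_eq _ _) (fun _ => zero_eq _ _)
  zero_nrmM zero_nrm_star.

End ZeroAlgebra.

Theorem theorem1p9 (R : realType) :
  exists A : cstarAlgType R,
    (~ exists I : set A, maximal_in (@stable_ideal R A) I) /\
    (~ exists I : set A, greatest_in (@stable_ideal R A) I).
Proof.
suff [A noA] : exists A : cstarAlgType R,
    ~ exists I : set A, maximal_in (@stable_ideal R A) I.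
  exists A; split=> // -[I [stI geI]]; apply: noA; exists I; split=> // J stJ IJ.
  by apply/seteqP; split=> //; exact: geI.
have [[K [rho Krho]]|noK] := pselect
  (exists (K : cstarAlgType R) (rho : K -> ell2 R -> ell2 R), is_compact_operators rho).
  have [p pu] := compact_operators_matrix_units Krho.
  by exists (tree_alg K); exact: tree_alg_no_maximal Krho pu.
(* Without a model [K] of the compact operators no ideal would be stable, so
   the existence of [K] is not needed. *)
exists (zero_alg R) => -[I [[_ [B [iota [_ [K [rho [Krho _]]]]]]] _]].
by apply: noK; exists K, rho.
Qed.
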